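(* Let $N\ge 2$, $p\ge 0$, $0\le q<2$, and define $$G(p,q)=\left((N-1)^2q+N-2\right)p^2+b(q)\,p-Nq^2,$$ where $$b(q)=N(N-1)q^2-(N^2+N-1)q-N-2.$$ If $G(p,q)<0$, then every positive solution of $$-\Delta u=u^p|\nabla u|^q\quad\text{in }\mathbb{R}^N$$ is constant.
   Context: Solutions are classical, i.e. of class $C^2$. *)

(* Defs.v *)
(* R is any realType and R^N is 'rV[R]_N. *)
From mathcomp Require Import all_boot all_order all_algebra.
From mathcomp Require Import all_classical all_reals all_analysis.

Set Implicit Arguments.
Unset Strict Implicit.
Unset Printing Implicit Defensive.

Import Order.TTheory GRing.Theory Num.Theory.
Import numFieldNormedType.Exports.

Local Open Scope classical_set_scope.
Local Open Scope ring_scope.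

Definition partial_deriv (R : realType) (N : nat) (i : 'I_N)
    (f : 'rV[R]_N -> R) : 'rV[R]_N -> R :=
  fun x => 'D_(delta_mx 0 i) f x.

Definition partially_derivable (R : realType) (N : nat) (i : 'I_N)
    (f : 'rV[R]_N -> R) : Prop :=
  forall x, derivable f x (delta_mx 0 i).

(* [derive] is total, so existence of each partial derivative is required
   separately from its continuity. *)
Definition classC1 (R : realType) (N : nat) (f : 'rV[R]_N -> R) : Prop :=
  continuous f /\
  forall i : 'I_N, partially_derivable i f /\ continuous (partial_deriv i f).

Definition classC2 (R : realType) (N : nat) (f : 'rV[R]_N -> R) : Prop :=
  classC1 f /\ forall i : 'I_N, classC1 (partial_deriv i f).

Definition gradient (R : realType) (N : nat) (f : 'rV[R]_N -> R)
    (x : 'rV[R]_N) : 'rV[R]_N :=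
  \row_i partial_deriv i f x.

(* The library norm `|v| on 'rV[R]_N is the sup norm, hence this definition. *)
Definition euclidean_norm (R : realType) (N : nat) (v : 'rV[R]_N) : R :=
  Num.sqrt (\sum_(i < N) v 0 i ^+ 2).

Definition laplacian (R : realType) (N : nat) (f : 'rV[R]_N -> R)
    (x : 'rV[R]_N) : R :=
  \sum_(i < N) partial_deriv i (partial_deriv i f) x.

(* For q = 0 the factor |grad u|^q is identically 1, also at critical points
   of u, since 0 `^ 0 = 1. *)
Definition positive_solution (R : realType) (N : nat) (p q : R)
    (u : 'rV[R]_N -> R) : Prop :=
  [/\ classC2 u,
      forall x, 0 < u x
    & forall x, - laplacian u x
                = u x `^ p * euclidean_norm (gradient u x) `^ q].

Definition bpoly (R : realType) (N : nat) (q : R) : R :=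
  N%:R * (N%:R - 1) * q ^+ 2 - (N%:R ^+ 2 + N%:R - 1) * q - N%:R - 2.

Definition Gpoly (R : realType) (N : nat) (p q : R) : R :=
  ((N%:R - 1) ^+ 2 * q + N%:R - 2) * p ^+ 2 + bpoly N q * p - N%:R * q ^+ 2.

(* Main.v *)
(* Let z = |grad u|^2, w = z / u, f = u^p |grad u|^q, H the Hessian of u and
   A = <H n, n> with n = grad u / |grad u|.  Testing against a cutoff eta, with
   the weight u^a z^e, the divergences of
     u^a z^e (H grad u - (Lap u) grad u),  u^a z^e f grad u,
     u^(a-1) z^(e+1) grad u
   integrate to boundary terms, while up to the weight they equal
     |H|^2 - f^2 + a w (A + f) + 2 e (|H n|^2 + f A),
     (a+p) f w + (2e+q) f A - f^2,  (a-1) w^2 + 2 (e+1) A w - f w.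
   By |H|^2 >= A^2 + (f + A)^2 / (N-1), the first minus k times the second minus
   s times the third dominates a quadratic form in (A, f, w).  If G(p,q) < 0 and
   (N-2) p + (N-1) q >= N, then a, e, k, s can be chosen so that this form is
   coercive for f, w >= 0; Young's inequality absorbs the boundary terms up to
   R^(N - tau) with tau > N, and R -> oo gives grad u = 0.  In the range
   (N-2) p + (N-1) q < N the field u^(-s) grad u alone suffices.

   No integral is needed: Riemann sums on dyadic grids are exactly invariant
   under dyadic shifts, so sums of derivatives of compactly supported functions
   tend to 0, and the second-order identity holds for u of class C^2. *)
Require Import Defs.
From mathcomp Require Import all_boot all_order all_algebra.
From mathcomp Require Import all_classical all_reals all_analysis.
From mathcomp Require Import ring lra.

Set Implicit Arguments.
Unset Strict Implicit.
Unset Printing Implicit Defensive.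

Import Order.TTheory GRing.Theory Num.Theory.
Import numFieldNormedType.Exports.

Local Open Scope classical_set_scope.
Local Open Scope ring_scope.

(** * The algebraic condition G < 0 *)

Lemma exists_small (R : realFieldType) (A B : R) : 0 < A -> 0 <= B ->
  exists x, [/\ 0 < x, x <= 1 & x * B < A].
Proof.
move=> A0 B0; have AB0 : 0 < A + B + 1 by lra.
exists (A / (A + B + 1)); split.
- exact: divr_gt0.
- by rewrite ler_pdivrMr //; lra.
- rewrite mulrAC ltr_pdivrMr //; nra.
Qed.

(* G(p,q) in terms of m = N - 1 *)
Definition Gm (R : realFieldType) (m p q : R) := (m ^+ 2 * q + m - 1) * p ^+ 2
  + ((m + 1) * m * q ^+ 2 - (m ^+ 2 + 3 * m + 1) * q - (m + 3)) * p
  - (m + 1) * q ^+ 2.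

Lemma large_q_discriminant (R : realFieldType) (m p q : R) :
  3 <= m -> 2 <= (m - 1) * q -> q < 2 -> 0 <= p ->
  m + 1 <= (m - 1) * p + m * q -> Gm m p q < 0 ->
  (m - 1) ^+ 2 * p ^+ 2 + p * (m * (m - 1) * q - m ^+ 2 - 2 * m + 2)
    - (m * q - 1) < 0.
Proof.
move=> m3 q1 q2 p0 psup; rewrite /Gm => G0.
rewrite ltNge; apply/negP; set E := (X in 0 <= X) => E0.
set A1 := - (m * (m - 1)) * q ^+ 2 + (4 * m ^+ 2 - 2 * m - 1) * q + (m - 1).
set A0 := (m ^+ 2 + m - 1) * q ^+ 2 - m * q - (m - 1).
have idE : (m - 1) ^+ 2 * Gm m p q
    = (m ^+ 2 * q + m - 1) * E + p * A1 + A0 by rewrite /E /Gm /A1 /A0; ring.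
have q0 : 0 < q by nra.
have A1ge : (2 * m ^+ 2 - 1) * q + (m - 1) <= A1.
  have : 0 <= q * (2 - q) * (m * (m - 1)) by apply: mulr_ge0; nra.
  rewrite /A1; lra.
have pA : 0 <= p * A1 + A0.
  have [q1'|q1'] := leP 1 q.
    have : 0 <= A0.
      have : 0 <= (q - 1) * ((m ^+ 2 + m - 1) * q + m ^+ 2 - 1).
        apply: mulr_ge0; nra.
      rewrite /A0; nra.
    have : 0 <= p * A1 by apply: mulr_ge0 => //; nra.
    lra.
  have : 0 <= (m - 1) * (p * A1 + A0); last by rewrite pmulr_rge0 //; lra.
  have : (m + 1 - m * q) * ((2 * m ^+ 2 - 1) * q + (m - 1))
      <= (m - 1) * p * A1.
    apply: ler_pM => //; [nra|nra|lra].
  suff : 0 <= (m + 1 - m * q) * ((2 * m ^+ 2 - 1) * q + (m - 1)) +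
     (m - 1) * A0 by lra.
  rewrite /A0.
  have h1 : 0 <= q * (1 - q) by nra.
  have h2 : 0 <= m ^+ 3 by apply: exprn_ge0; lra.
  have := mulr_ge0 h1 h2.
  have : 0 <= q * m ^+ 3 by apply: mulr_ge0 => //; lra.
  have : 0 <= q * m by nra.
  have : 0 <= (m - 1) * (q * (1 - q)) by apply: mulr_ge0 => //; lra.
  lra.
have : 0 <= (m - 1) ^+ 2 * Gm m p q.
  rewrite idE; have : 0 <= (m ^+ 2 * q + m - 1) * E.
    apply: mulr_ge0 => //; nra.
  lra.
rewrite pmulr_rge0; last by nra.
by rewrite leNgt G0.
Qed.

Lemma large_q_exponent_lt0 (R : realFieldType) (m p q : R) :
  3 <= m -> 2 <= (m - 1) * q -> q < 2 -> 0 <= p ->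
  (m - 1) ^+ 2 * p ^+ 2 + p * (m * (m - 1) * q - m ^+ 2 - 2 * m + 2)
    - (m * q - 1) < 0 ->
  (m - 1) * p * ((m - 1) * q ^+ 2 - m * q + 2) < 2 * (m * q - 1).
Proof.
move=> m3 q1 q2 p0 E0.
set D := _ - _ + 2; set P := (m - 1) * p; set b := m * q - 1.
have X0 : 0 < m - 1 by lra.
have b0 : 0 < b by rewrite /b; nra.
have P0 : 0 <= P by rewrite /P; nra.
rewrite ltNge; apply/negP => h.
have D0 : 0 < D.
  rewrite ltNge; apply/negP => D0; have := mulr_ge0_le0 P0 D0; lra.
have P1 : 0 < P.
  rewrite lt0r P0 andbT; apply/eqP => P1; move: h; rewrite P1 mul0r; lra.
pose K := m * (m - (m - 1) * q) + 2 * (m - 1).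
have T0 : (m - 1) * P ^+ 2 < P * K + (m - 1) * b.
  have : 0 < (m - 1) * (-((m - 1) ^+ 2 * p ^+ 2 + p * (m * (m - 1) * q - m ^+ 2 - 2 * m + 2) - b)).
    by apply: mulr_gt0 => //; rewrite oppr_gt0.
  rewrite /P /K; nra.
have T1 : (m - 1) * P < K + (m - 1) * D / 2.
  rewrite -(ltr_pM2l P1).
  have : (m - 1) * (2 * b) <= (m - 1) * (P * D) by rewrite ler_pM2l.
  lra.
have T2 : (m - 1) * (2 * b) < (K + (m - 1) * D / 2) * D.
  apply: (@le_lt_trans _ _ ((m - 1) * P * D)).
    by rewrite -mulrA ler_pM2l.
  by rewrite ltr_pM2r.
have : (2 * K + (m - 1) * D) * D <= 4 * (m - 1) * b; last by lra.
rewrite /K /D /b.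
clear - X0 q1 q2 m3.
pose X := m - 1; pose r := 2 - q.
have -> : m = X + 1 by rewrite /X; ring.
have -> : q = 2 - r by rewrite /r; ring.
have X2 : 2 <= X by rewrite /X; lra.
have r0 : 0 < r by rewrite /r; lra.
have rX : r * X <= 2 * X - 2 by rewrite /r /X; lra.
rewrite -subr_le0.
set Q := (X in X <= 0).
have -> : Q = r * (-2 * (X^+3+X^+2-X-1) + (5*X^+3-6*X^+2+5*X) * r
   - 4 * X^+2*(X-1) * r^+2 + X^+3*r^+3) by rewrite /Q; ring.
rewrite pmulr_rle0 //.
have h1 : 0 <= (r - 1) ^+ 2 * (X ^+ 2 * (2 * X - 2 - r * X)).
  by apply: mulr_ge0; [exact: sqr_ge0 | apply: mulr_ge0; [exact: sqr_ge0|lra]].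
have h2 : 0 <= (X * (r + 1)) * (2 * X - 2 - r * X).
  by apply: mulr_ge0; [apply: mulr_ge0; lra | lra].
lra.
Qed.

(* To be used with X = N - 2, v = 1 - q and t = (N - 2) (p + q - 1). *)
Lemma large_q_growth (R : realFieldType) (X v t : R) :
  2 <= X -> 0 < v -> 2 <= X * (1 - v) -> 0 < t ->
  t * (t + X * v - 3 - v - X^-1) < X * (1 + v) ^+ 2 ->
  t * (X ^+ 2 * v + 2 * X * v ^+ 2 + v - X * (1 - v) ^+ 2)
    < X * (1 + v) ^+ 2 * (X * (2 - v) + 1).
Proof.
move=> X2 v0 Xv t0 T.
set C := _ + v - _; set Z := _ * _ + 1.
have v1 : v < 1 by nra.
have Xi0 : 0 < X^-1 by rewrite invr_gt0; lra.
have XXi : X * X^-1 = 1 by rewrite divff //; apply: lt0r_neq0; lra.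
have Xi1 : X^-1 <= 2^-1 by rewrite lef_pV2 ?posrE //; lra.
have Z0 : 0 < Z by rewrite /Z; nra.
have X0 : 0 < X by lra.
have rhs0 : 0 < X * (1 + v) ^+ 2 * Z.
  by rewrite !mulr_gt0 //; nra.
have [C0|C0] := leP C 0.
  by apply: le_lt_trans rhs0; rewrite pmulr_rle0.
rewrite ltNge; apply/negP => h.
have h1 : t + X * v - 3 - v - X^-1 < C / Z.
  rewrite ltr_pdivlMr // -(ltr_pM2l t0) mulrA.
  apply: lt_le_trans h; by rewrite ltr_pM2r.
have h2 : C * (C + (3 + v + X^-1 - X * v) * Z) <= X * (1 + v) ^+ 2 * Z ^+ 2.
  have -> : C + (3 + v + X^-1 - X * v) * Z
     = - (X ^+ 2 * v * (1 - v)) + 5 * X + 5 + v + X^-1.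
    have e1 : X^-1 * Z = 2 - v + X^-1.
      by rewrite /Z mulrDr mulr1 mulrA mulVf ?mul1r //; apply: lt0r_neq0.
    have -> : (3 + v + X^-1 - X * v) * Z
      = (3 + v - X * v) * Z + X^-1 * Z by ring.
    by rewrite e1 /C /Z; ring.
  have Xv2 : 0 <= (X * v) * (X * (1 - v) - 2).
    by apply: mulr_ge0; [nra|lra].
  apply: (@le_trans _ _ (C * (X * (5 - 2 * v) + 11 / 2 + v))).
    by rewrite ler_pM2l //; lra.
  apply: (@le_trans _ _ ((X ^+ 2 * v + 2 * X * v ^+ 2 + v)
       * (X * (5 - 2 * v) + 11 / 2 + v))).
    rewrite ler_pM2r; last by nra.
    by rewrite /C lerBlDr lerDl; apply: mulr_ge0; [lra|exact: sqr_ge0].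
  rewrite /Z -subr_ge0; set Q := (X in 0 <= X).
  have -> : Q = X ^+ 3 * (4 - v - v ^+ 2 - 2 * v ^+ 3 + v ^+ 4)
     + X ^+ 2 * (4 + v / 2 - 11 * v ^+ 2 + 2 * v ^+ 3)
     + X * (1 - 3 * v - 8 * v ^+ 2 - 2 * v ^+ 3) - v * (11 / 2 + v).
    by rewrite /Q; field.
  have X2v : 2 * (1 + v) <= X.
    have : 2 * (1 + v) * (1 - v) <= X * (1 - v) by nra.
    by rewrite ler_pM2r //; lra.
  have XX0 : 0 < X ^+ 2 by rewrite exprn_gt0.
  have k1 : X * (4 * (1 + v) ^+ 2) <= X ^+ 3.
    rewrite exprS ler_pM2l //.
    have : (2 * (1 + v)) ^+ 2 <= X ^+ 2 by rewrite ler_pXn2r ?nnegrE //; lra.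
    by rewrite exprMn; lra.
  have k2 : X ^+ 2 * (4 + 6 * v)
     <= X ^+ 3 * (3 - v - v ^+ 2 - 2 * v ^+ 3 + v ^+ 4).
    rewrite [X ^+ 3]exprSr -mulrA ler_pM2l //.
    apply: (@le_trans _ _ (X * ((1 - v) * (2 + 3 * v)))).
      rewrite mulrA; have : 2 * (2 + 3 * v) <= X * (1 - v) * (2 + 3 * v).
        by rewrite ler_pM2r //; lra.
      lra.
    rewrite ler_pM2l // -subr_ge0.
    have -> : 3 - v - v ^+ 2 - 2 * v ^+ 3 + v ^+ 4 - (1 - v) * (2 + 3 * v)
       = (1 - v) ^+ 2 * (1 + v ^+ 2) by ring.
    by apply: mulr_ge0; [exact: sqr_ge0 | have := sqr_ge0 v; lra].
  have v3 : 0 <= v ^+ 3 by apply: exprn_ge0; exact: ltW.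
  have v2 : v ^+ 2 <= v by rewrite expr2 ger_pMl //; exact: ltW.
  have k3 : 0 <= X ^+ 2 * (8 + 13 / 2 * v - 11 * v ^+ 2 + 2 * v ^+ 3 - 7 / 2).
    apply: mulr_ge0; first exact: ltW.
    have : 0 <= (1 - v) * (9 / 2 + 11 * v) by apply: mulr_ge0; lra.
    lra.
  have k4 : 0 <= X * (5 + 5 * v - 4 * v ^+ 2 - 2 * v ^+ 3).
    apply: mulr_ge0; first exact: ltW.
    have : v ^+ 3 <= v ^+ 2 by rewrite exprS ger_pMl ?exprn_gt0 //; exact: ltW.
    lra.
  have k5 : v * (11 / 2 + v) <= X ^+ 2 * (7 / 2).
    have : 2 ^+ 2 <= X ^+ 2 by rewrite ler_pXn2r ?nnegrE //; lra.
    lra.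
  lra.
have : C * (C + (3 + v + X^-1 - X * v) * Z) > X * (1 + v) ^+ 2 * Z ^+ 2.
  have h3 : X * (1 + v) ^+ 2 * Z < C * (C / Z + 3 + v + X^-1 - X * v).
    apply: (le_lt_trans h); rewrite mulrC ltr_pM2l //; lra.
  have : X * (1 + v) ^+ 2 * Z * Z < C * (C / Z + 3 + v + X^-1 - X * v) * Z.
    by rewrite ltr_pM2r.
  have -> : C * (C / Z + 3 + v + X^-1 - X * v) * Z =
       C * (C / Z * Z + (3 + v + X^-1 - X * v) * Z) by ring.
  by rewrite divfK ?lt0r_neq0 // expr2 !mulrA.
by rewrite ltNge h2.
Qed.

(* The second group makes the quadratic form in (A, f, w) positive after the
   minimisation over A (the coefficient of A^2 is M, those of f A and A w are B
   and D); the first group makes the remainder of Young's inequality decay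
   faster than the volume of balls grows. *)
Definition good_params (R : realFieldType) (m p q e a k s : R) :=
  let M := (m + 1) / m + 2 * e in
  let B := 2 / m + 2 * e - k * (2 * e + q) in
  let D := a - 2 * (e + 1) * s in
  [/\ 0 <= e, a <= 0, 0 < a + 2 * e + 2 &
      (m - 3 - 2 * e) * (p + q - 1) < (2 - q) * (a + 2 * e + 2)] /\
  [/\ B ^+ 2 < 4 * M * (k - (m - 1) / m), D ^+ 2 < 4 * M * (s * (1 - a)) &
      B * D <= 2 * M * (a - k * (a + p) + s)].

Lemma good_params_e0 (R : realFieldType) (m p q a s : R) :
  2 <= m -> 0 <= q -> q < 2 -> m ^+ 2 * q <= 4 * (m + 1) ->
  a <= 0 -> 0 < a + 2 -> (m - 3) * (p + q - 1) < (2 - q) * (a + 2) ->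
  (a - 2 * s) ^+ 2 < 4 * ((m + 1) / m) * (s * (1 - a)) ->
  (2 / m - m / (m + 1) * q) * (a - 2 * s)
    < 2 * ((m + 1) / m) * (a - m / (m + 1) * (a + p) + s) ->
  exists e a' k s', good_params m p q e a' k s'.
Proof.
move=> m2 q0 q2 mq a0 a2 hB hW hK.
have m0 : 0 < m by lra.
have mn0 : m != 0 by apply: lt0r_neq0.
have m1n0 : m + 1 != 0 by apply: lt0r_neq0; lra.
set k0 := m / (m + 1) in hK *.
set g := 2 * ((m + 1) / m) * (a - k0 * (a + p) + s) - (2 / m - k0 * q) * (a - 2 * s).
have g0 : 0 < g by rewrite subr_gt0.
have im0 : 0 < m^-1 by rewrite invr_gt0.
have [x [x0 _ xg]] := exists_small g0 (normr_ge0 (- q * (a - 2 * s) + 2 * ((m + 1) / m) * (a + p))).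
have [y [y0 _ ym]] := exists_small im0 (@ler01 R).
have k0q : k0 * q <= 4 / m.
  rewrite /k0 mulrAC ler_pdivrMr; last by lra.
  by rewrite mulrAC ler_pdivlMr //; lra.
have k0q0 : 0 <= k0 * q by apply: mulr_ge0 => //; apply: divr_ge0; lra.
pose z := Num.min x y.
have z0 : 0 < z by rewrite lt_min x0.
have zx : z <= x by rewrite ge_min lexx.
have zy : z < m^-1 by apply: le_lt_trans (_ : y < _); [rewrite ge_min lexx orbT|lra].
exists 0, a, (k0 + z), s; split; first by split; lra.
split; rewrite ?mulr0 ?add0r ?addr0 ?mulr1.
- have e1 : 4 * ((m + 1) / m) * (k0 + z - (m - 1) / m) - (2 / m - (k0 + z) * q) ^+ 2
    = (k0 * q) * (4 / m - k0 * q)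
     + z * (4 * (1 - q / m + m^-1) + q * 2 * (4 / m - k0 * q) - q ^+ 2 * z).
    rewrite /k0; field; apply/andP; split=> //.
  rewrite -subr_gt0 e1; apply: ltr_wpDl; first by apply: mulr_ge0; lra.
  apply: mulr_gt0 => //.
  have : q / m <= 1 by rewrite ler_pdivrMr //; lra.
  have : 0 <= q * 2 * (4 / m - k0 * q) by apply: mulr_ge0; lra.
  have : q ^+ 2 * z < 4 * m^-1.
    apply: (@le_lt_trans _ _ (4 * z)); last by rewrite ltr_pM2l.
    by rewrite ler_pM2r //; nra.
  lra.
- by [].
- rewrite -subr_ge0; set S := (X in 0 <= X).
  have -> : S = g - z * (- q * (a - 2 * s) + 2 * ((m + 1) / m) * (a + p)).
    by rewrite /S /g; ring.
  rewrite subr_ge0; apply: le_trans (ltW xg).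
  apply: le_trans (ler_norm _) _; rewrite normrM (gtr0_norm z0).
  by apply: ler_wpM2r.
Qed.

Lemma Gm_lt0_le (R : realFieldType) (m p q x : R) : 1 <= m -> 0 <= q ->
  0 < x -> x <= p -> Gm m p q < 0 -> Gm m x q < 0.
Proof.
move=> m1 q0 x0 xp G0.
have p0 : 0 < p by lra.
have : p * Gm m x q <= x * Gm m p q.
  rewrite -subr_ge0; have -> : x * Gm m p q - p * Gm m x q =
   (p - x) * (p * x * (m ^+ 2 * q + m - 1) + (m + 1) * q ^+ 2) by rewrite /Gm; ring.
  apply: mulr_ge0; first lra.
  apply: addr_ge0; apply: mulr_ge0; [nra|nra|lra|exact: sqr_ge0].
move=> h; rewrite -(pmulr_rlt0 _ p0); apply: le_lt_trans h _.
by rewrite pmulr_rlt0.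
Qed.

Lemma good_params_small_q (R : realFieldType) (m p q : R) :
  m = 2 /\ q <= 1 \/ 3 <= m /\ (m - 1) * q <= 2 -> 0 <= q -> 0 <= p ->
  m + 1 <= (m - 1) * p + m * q -> Gm m p q < 0 ->
  exists e a k s, good_params m p q e a k s.
Proof.
move=> hm q0 p0 psup G0.
have m2 : 2 <= m by case: hm => -[]; lra.
have q1 : q <= 1 by case: hm => -[] // m3 mq; nra.
have c0 : 0 < m + 3 - m * q by nra.
have X0 : 0 < m - 1 by lra.
have Xn0 : m - 1 != 0 by apply: lt0r_neq0.
have sub : (m - 1) * p + m * q < m + 3.
  rewrite ltNge; apply/negP => h.
  have px : (m + 3 - m * q) / (m - 1) <= p by rewrite ler_pdivrMr //; lra.
  have x0 : 0 < (m + 3 - m * q) / (m - 1) by apply: divr_gt0.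
  have := Gm_lt0_le (ltac:(lra) : 1 <= m) q0 x0 px G0.
  have -> : Gm m ((m + 3 - m * q) / (m - 1)) q =
    q * (m ^+ 2 * q ^+ 2 - (m + 1) ^+ 3 * q + (m + 3) * (3 * m + 1)) / (m - 1) ^+ 2.
    by rewrite /Gm; field.
  apply/negP; rewrite -leNgt; apply: divr_ge0; last exact: sqr_ge0.
  apply: mulr_ge0 => //.
  case: hm => -[h1 h2].
    by rewrite h1; nra.
  have X2 : 0 < (m - 1) ^+ 2 by apply: exprn_gt0.
  rewrite -(pmulr_rge0 _ X2).
  pose r := 2 - (m - 1) * q.
  have r0 : 0 <= r by rewrite /r; lra.
  have -> : (m - 1) ^+ 2 * (m ^+ 2 * q ^+ 2 - (m + 1) ^+ 3 * q + (m + 3) * (3 * m + 1))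
    = m ^+ 2 * r ^+ 2 + r * ((m + 1) ^+ 3 * (m - 1) - 4 * m ^+ 2)
      + (4 * m ^+ 2 + (m - 1) * (m ^+ 3 + m ^+ 2 - 13 * m - 5)).
    by rewrite /r; ring.
  pose y := m - 3; have -> : m = y + 3 by rewrite /y; ring.
  have y0 : 0 <= y by rewrite /y; lra.
  apply: addr_ge0; [apply: addr_ge0|].
  - by apply: mulr_ge0; apply: sqr_ge0.
  - by apply: mulr_ge0 => //; have := exprn_ge0 2 y0; have := exprn_ge0 3 y0;
      have := exprn_ge0 4 y0; lra.
  - by have := exprn_ge0 2 y0; have := exprn_ge0 3 y0; have := exprn_ge0 4 y0; lra.
(* a = - 2 s / m centres the ellipse of admissible (a, s); any s between the two
   bounds below is admissible. *)
pose s := (m * p / (m + 3 - m * q) + m / (m - 1)) / 2.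
have s1 : m * p / (m + 3 - m * q) < m / (m - 1).
  by rewrite ltr_pdivrMr // mulrAC ltr_pdivlMr //; nra.
have s2 : m * p < s * (m + 3 - m * q).
  by rewrite -ltr_pdivrMr // /s; lra.
have s3 : s * (m - 1) < m.
  by rewrite -ltr_pdivlMr // /s; lra.
have s0 : 0 < s.
  by rewrite -(pmulr_lgt0 _ c0); apply: le_lt_trans s2; apply: mulr_ge0; lra.
clearbody s.
have m0 : 0 < m by lra.
have mn0 : m != 0 by apply: lt0r_neq0.
have m1n0 : m + 1 != 0 by apply: lt0r_neq0; lra.
have pq1 : 0 < (m - 1) * (p + q - 1) by nra.
have pq : 0 < p + q - 1 by rewrite -(pmulr_rgt0 _ X0).
have sm : s / m * (m - 1) < 1 by rewrite mulrAC ltr_pdivrMr //; lra.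
have sm0 : 0 < s / m by apply: divr_gt0.
apply: (@good_params_e0 _ m p q (- 2 * (s / m)) s) => //.
- lra.
- case: hm => -[h1 h2]; first by rewrite h1; lra.
  have : 0 <= m ^+ 2 * (2 - (m - 1) * q) by apply: mulr_ge0; [exact: sqr_ge0|lra].
  have : m ^+ 2 * q * (m - 1) <= 4 * (m + 1) * (m - 1) by nra.
  by rewrite ler_pM2r.
- lra.
- nra.
- have [m3|m3] := ltP m 3.
    apply: (@le_lt_trans _ _ 0); first by rewrite nmulr_rle0 //; lra.
    apply: mulr_gt0; nra.
  case: hm => -[h1 h2]; first by lra.
  rewrite -(ltr_pM2r X0).
  apply: (@le_lt_trans _ _ ((m - 3) * (4 - q))).
    by rewrite -mulrA; apply: ler_wpM2l; lra.
  apply: (@lt_trans _ _ ((2 - q) * (2 * (m - 2)))); first by lra.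
  by rewrite -mulrA ltr_pM2l; lra.
- rewrite -subr_gt0; have -> : 4 * ((m + 1) / m) * (s * (1 - - 2 * (s / m))) -
   (- 2 * (s / m) - 2 * s) ^+ 2 = 4 * (m + 1) * s * (m - s * (m - 1)) / m ^+ 2.
    by field.
  by rewrite divr_gt0 ?mulr_gt0 ?exprn_gt0 //; lra.
- rewrite -subr_gt0; set S := (X in 0 < X).
  have -> : S = 2 / m * (s * (m + 3 - m * q) - m * p).
    by rewrite /S; field; apply/andP.
  by rewrite mulr_gt0 ?divr_gt0 //; lra.
Qed.

Lemma good_params_dim3 (R : realFieldType) (p q : R) :
  1 <= q -> q < 2 -> 0 <= p -> 3 <= p + 2 * q -> Gm 2 p q < 0 ->
  exists e a k s, good_params 2 p q e a k s.
Proof.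
move=> q1 q2 p0 psup G0.
have sub : 4 * p < 15 - 4 * q.
  rewrite ltNge; apply/negP => h.
  have px : (15 - 4 * q) / 4 <= p by lra.
  have x0 : 0 < (15 - 4 * q) / 4 by lra.
  have := Gm_lt0_le (ltac:(lra) : 1 <= (2 : R)) (ltac:(lra) : 0 <= q) x0 px G0.
  apply/negP; rewrite -leNgt /Gm.
  nra.
have c0 : 0 < 5 - 4 * q / 3 by lra.
pose s := (2 * p / (5 - 4 * q / 3) + 3 / 2) / 2.
have s1 : 2 * p / (5 - 4 * q / 3) < 3 / 2 by rewrite ltr_pdivrMr //; lra.
have s2 : 2 * p < s * (5 - 4 * q / 3) by rewrite -ltr_pdivrMr // /s; lra.
have s3 : s < 3 / 2 by rewrite /s; lra.
have s0 : 0 < s by rewrite -(pmulr_lgt0 _ c0); lra.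
clearbody s.
have i3 : (2 : R) / (2 + 1) = 2 / 3 by field.
have ws : 0 < s * (6 - 4 * s) by apply: mulr_gt0; lra.
apply: (@good_params_e0 _ 2 p q 0 s); rewrite ?i3 //; first [lra | nra].
Qed.

Lemma good_params_large_q (R : realFieldType) (m p q : R) :
  3 <= m -> 2 <= (m - 1) * q -> q < 2 -> 0 <= p ->
  m + 1 <= (m - 1) * p + m * q -> Gm m p q < 0 ->
  exists e a k s, good_params m p q e a k s.
Proof.
move=> m3 q1 q2 p0 psup G0.
have E0 := large_q_discriminant m3 q1 q2 p0 psup G0.
have N0 := large_q_exponent_lt0 m3 q1 q2 p0 E0.
have q0 : 0 < q by nra.
have pq1 : 0 < (m - 1) * (p + q - 1) by nra.
have X0 : 0 < m - 1 by lra.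
have pq : 0 < p + q - 1 by rewrite -(pmulr_rgt0 _ X0).
have mn0 : m != 0 by apply: lt0r_neq0; lra.
have m0 : 0 < m by lra.
have im0 : 0 < m^-1 by rewrite invr_gt0.
have Xn0 : m - 1 != 0 by apply: lt0r_neq0.
set P := (m - 1) * p in N0.
have P0 : 0 <= P by apply: mulr_ge0; lra.
pose b := m * q - 1.
have b0 : 0 < b by rewrite /b; nra.
pose c := m - (m - 1) * q.
pose den := c ^+ 2 + 4 * (m - 1).
have den0 : 0 < den by rewrite /den; have := sqr_ge0 c; lra.
have denn0 : den != 0 by apply: lt0r_neq0.
pose num := P * (c + 2 * (m - 1) / m) + 2 * (m - 1) / m * b.
pose s := num / den.
have sden : s * den = num by rewrite divfK.
(* With 2 e = (m - 1) q - 2 and k = (m - 1) / m the coefficients of f^2 and f A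
   vanish and that of f w is nonnegative iff P <= a + m s; on the line
   a = P - m s, this s minimises the quadratic function to be made negative.
   Small perturbations of a and k then give strict inequalities. *)
pose a0 := P - m * s.
pose M := (m - 1) * b / m.
have M0 : 0 < M by apply: divr_gt0 => //; apply: mulr_gt0.
have disc : P ^+ 2 * den < num ^+ 2.
  rewrite -subr_gt0; have -> : num ^+ 2 - P ^+ 2 * den = 4 * (m - 1) ^+ 2 / m ^+ 2 * b *
    - ((m - 1) ^+ 2 * p ^+ 2 + p * (m * (m - 1) * q - m ^+ 2 - 2 * m + 2) - (m * q - 1)).
    by rewrite /num /den /P /b /c; field.
  apply: mulr_gt0; last by rewrite oppr_gt0.
  by rewrite mulr_gt0 ?divr_gt0 ?mulr_gt0 ?exprn_gt0.
have W0 : 0 < 4 * M * (s * (1 - a0)) - (a0 - (m - 1) * q * s) ^+ 2.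
  rewrite -(pmulr_lgt0 _ den0).
  have -> : (4 * M * (s * (1 - a0)) - (a0 - (m - 1) * q * s) ^+ 2) * den =
    (2 * num - (s * den)) * (s * den) - P ^+ 2 * den.
    by rewrite /num /den /M /a0 /b /c; field.
  by rewrite sden; nra.
have aneg : a0 < 0.
  rewrite -(pmulr_llt0 _ den0).
  have -> : a0 * den = P * den - m * (s * den) by rewrite /a0; ring.
  rewrite sden.
  have -> : P * den - m * num = (m - 1) * (P * ((m - 1) * q ^+ 2 - m * q + 2) - 2 * (m * q - 1)).
    by rewrite /num /den /b /c; field.
  by rewrite pmulr_rlt0 // subr_lt0.
have aden : (a0 + (m - 1) * q) * den =
    (m - 1) * (P * (2 - c * q) + q * den - 2 * b).
  have -> : (a0 + (m - 1) * q) * den = P * den - m * (s * den) + (m - 1) * q * den.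
    by rewrite /a0; ring.
  by rewrite sden /num /den /b /c; field.
have B12 : 0 < a0 + (m - 1) * q /\
   (m - 1) * (1 - q) * (p + q - 1) < (2 - q) * (a0 + (m - 1) * q).
  have [q1'|q1'] := leP 1 q.
    have B1 : 0 < a0 + (m - 1) * q.
      rewrite -(pmulr_lgt0 _ den0) aden; apply: mulr_gt0 => //.
      have c1 : c <= 1 by rewrite /c; nra.
      have : 0 <= P * (2 - c * q).
        apply: mulr_ge0 => //; rewrite subr_ge0.
        by apply: (@le_trans _ _ (1 * q)); [rewrite ler_pM2r|lra].
      have : 0 <= q * c ^+ 2 by apply: mulr_ge0; [lra|exact: sqr_ge0].
      rewrite /den /b; nra.
    split => //; apply: (@le_lt_trans _ _ 0).
      by rewrite mulrAC pmulr_rle0 ?mulr_gt0 //; lra.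
    by apply: mulr_gt0 => //; lra.
  suff B2 : (m - 1) * (1 - q) * (p + q - 1) < (2 - q) * (a0 + (m - 1) * q).
    split=> //; have : 0 < (2 - q) * (a0 + (m - 1) * q).
      by apply: le_lt_trans B2; rewrite !mulr_ge0 //; lra.
    by rewrite pmulr_rgt0 //; lra.
  rewrite -(ltr_pM2r den0) -[X in _ < X]mulrA aden.
  pose v := 1 - q.
  pose t := (m - 1) * (p + q - 1).
  have tE : t * (t + (m - 1) * v - 3 - v - (m - 1)^-1) < (m - 1) * (1 + v) ^+ 2.
    rewrite -subr_gt0; have -> : (m - 1) * (1 + v) ^+ 2 - t * (t + (m - 1) * v - 3 - v - (m - 1)^-1)
     = - ((m - 1) ^+ 2 * p ^+ 2 + p * (m * (m - 1) * q - m ^+ 2 - 2 * m + 2) - (m * q - 1)).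
      by rewrite /v /t; field.
    by rewrite oppr_gt0.
  have := large_q_growth (X := m - 1) (v := v) (t := t) _ _ _ _ tE.
  move=> /(_ ltac:(lra)) /(_ ltac:(rewrite /v; lra)) /(_ ltac:(rewrite /v; lra)) /(_ pq1).
  move=> L0; rewrite -subr_gt0 in L0; move: L0.
  set L := (X in 0 < X -> _) => L0.
  rewrite -subr_gt0; set L' := (X in 0 < X).
  by have <- : L = L' by rewrite /L /L' /t /v /den /b /P /c; ring.
have [B1 B2] := B12.
have [x [x0 x1 xW]] := exists_small W0 (normr_ge0 (2 * (a0 - (m - 1) * q * s) + 1 + 4 * M * s)).
have na0 : 0 < - a0 by rewrite oppr_gt0.
have [y [y0 _ ya]] := exists_small na0 (@ler01 R).
pose z := Num.min x y.
have z0 : 0 < z by rewrite lt_min x0.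
have zx : z <= x by rewrite ge_min lexx.
have zy : z <= y by rewrite ge_min lexx orbT.
pose a := a0 + z.
have g1 : 0 < 2 * M * (z / m) by rewrite !mulr_gt0.
have [w [w0 _ wK]] := exists_small g1 (normr_ge0 (2 * M * (a + p) - (m * q - 2) * (a - (m - 1) * q * s))).
have g2 : 0 < 4 * M by rewrite mulr_gt0.
have [r [r0 _ rF]] := exists_small g2 (sqr_ge0 (m * q - 2)).
pose k := Num.min w r.
have k0 : 0 < k by rewrite lt_min w0.
have kw : k <= w by rewrite ge_min lexx.
have kr : k <= r by rewrite ge_min lexx orbT.
exists (((m - 1) * q - 2) / 2), a, ((m - 1) / m + k), s.
split; first split.
- lra.
- rewrite /a; lra.
- rewrite /a; lra.
- rewrite [ltLHS](_ : _ = (m - 1) * (1 - q) * (p + q - 1)); last by field.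
  apply: (lt_le_trans B2); rewrite /a; apply: ler_wpM2l; lra.
have -> : (m + 1) / m + 2 * (((m - 1) * q - 2) / 2) = M by rewrite /M /b; field.
have -> : 2 / m + 2 * (((m - 1) * q - 2) / 2) -
   ((m - 1) / m + k) * (2 * (((m - 1) * q - 2) / 2) + q) = - (k * (m * q - 2)) by field.
have -> : 2 * (((m - 1) * q - 2) / 2 + 1) * s = (m - 1) * q * s by field.
split.
- rewrite sqrrN exprMn (addrC _ k) addrK expr2 -mulrA [ltRHS]mulrC ltr_pM2l //.
  by apply: le_lt_trans rF; apply: ler_wpM2r => //; exact: sqr_ge0.
- rewrite -subr_gt0.
  have -> : 4 * M * (s * (1 - a)) - (a - (m - 1) * q * s) ^+ 2 =
    (4 * M * (s * (1 - a0)) - (a0 - (m - 1) * q * s) ^+ 2)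
     - z * (2 * (a0 - (m - 1) * q * s) + z + 4 * M * s) by rewrite /a; ring.
  rewrite subr_gt0; apply: le_lt_trans xW.
  apply: (@le_trans _ _ (z * (2 * (a0 - (m - 1) * q * s) + 1 + 4 * M * s))).
    by rewrite ler_pM2l // lerD2r lerD2l; lra.
  apply: (@le_trans _ _ (z * `|2 * (a0 - (m - 1) * q * s) + 1 + 4 * M * s|)).
    by rewrite ler_pM2l // ler_norm.
  by apply: ler_wpM2r.
- rewrite -subr_ge0; set S := (X in 0 <= X).
  have -> : S = 2 * M * (z / m) - k * (2 * M * (a + p) - (m * q - 2) * (a - (m - 1) * q * s)).
    by rewrite /S /a /a0 /P; field.
  rewrite subr_ge0; apply: le_trans (ltW wK).
  apply: le_trans (_ : k * `|2 * M * (a + p) - (m * q - 2) * (a - (m - 1) * q * s)| <= _).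
    by rewrite ler_pM2l // ler_norm.
  by apply: ler_wpM2r.
Qed.

Lemma good_params_exist (R : realFieldType) (N : nat) (p q : R) :
  (3 <= N)%N -> 0 <= q -> q < 2 -> 0 <= p ->
  N%:R <= (N%:R - 2) * p + (N%:R - 1) * q -> Gm (N%:R - 1) p q < 0 ->
  exists e a k s, good_params (N%:R - 1) p q e a k s.
Proof.
move=> N3 q0 q2 p0 psup G0; set m := N%:R - 1 in G0 *.
have ps : m + 1 <= (m - 1) * p + m * q by rewrite /m; lra.
have [N4|] := leqP 4 N; last first.
  rewrite ltnS => N3'; have eN : N = 3 by apply/eqP; rewrite eqn_leq N3' N3.
  have em : m = 2 by rewrite /m eN; lra.
  rewrite em in G0 ps *.
  have [q1|q1] := leP q 1.
    by apply: good_params_small_q => //; left.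
  by apply: good_params_dim3 => //; lra.
have m3 : 3 <= m.
  have : 4%:R <= N%:R :> R by rewrite ler_nat.
  rewrite /m; lra.
have [h|h] := leP 2 ((m - 1) * q).
  exact: good_params_large_q.
by apply: good_params_small_q => //; right; split=> //; exact: ltW.
Qed.

(** * Riemann sums on dyadic grids *)

Lemma coord_norm_le (R : realType) (N : nat) (x : 'rV[R]_N) (i : 'I_N) :
  `|x 0 i| <= `|x|.
Proof.
rewrite [leRHS]/Num.norm /= mx_normrE.
by apply/bigmax_geP; right => /=; exists (0, i).
Qed.

Lemma rV_norm_le (R : realType) (N : nat) (x : 'rV[R]_N) (r : R) : 0 <= r ->
  (forall i, `|x 0 i| <= r) -> `|x| <= r.
Proof.
move=> r0 h; rewrite [leLHS]/Num.norm /= mx_normrE.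
by apply/bigmax_leP; split => //= -[i j] _ /=; rewrite (ord1 i).
Qed.

Lemma norm_delta_mx (R : realType) (N : nat) (i : 'I_N) :
  `|delta_mx 0 i : 'rV[R]_N| <= 1.
Proof.
apply: rV_norm_le => // j; rewrite mxE eqxx /=.
by case: (_ == _); rewrite ?normr1 ?normr0.
Qed.

Lemma compact_rV_ball (R : realType) (N : nat) (L : R) :
  compact [set x : 'rV[R]_N | `|x| <= L].
Proof.
apply: bounded_closed_compact.
  by exists L; split => [|M LM x /= xL]; [exact: num_real|exact: le_trans (ltW LM)].
apply: (@closed_comp _ _ (fun x : 'rV[R]_N => `|x|) [set y | y <= L]).
  by move=> x _; exact: norm_continuous.
exact: closed_le.
Qed.

Lemma continuous_bounded (R : realType) (N : nat) (g : 'rV[R]_N -> R) (L : R) :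
  continuous g -> exists2 B, 0 <= B & forall x, `|x| <= L -> `|g x| <= B.
Proof.
move=> gc.
have /compact_bounded [M [_ hM]] : compact (g @` [set x | `|x| <= L]).
  apply: continuous_compact; last exact: compact_rV_ball.
  exact: continuous_subspaceT.
exists (Num.max M 0 + 1); first by rewrite addr_ge0 // le_max lexx orbT.
move=> x xL; apply: hM; last by exists x.
by rewrite ltr_pwDr // le_max lexx.
Qed.

Lemma unif_continuous_ball (R : realType) (N : nat) (g : 'rV[R]_N -> R) (L eps : R) :
  continuous g -> 0 < eps -> exists2 d, 0 < d &
  forall x y, `|x| <= L -> `|y - x| < d -> `|g y - g x| < eps.
Proof.
move=> gc e0.
have /compact_near_coveringP /(_ _ (0 : R)^'+ 
  (fun d x => forall y, `|y - x| < d -> `|g y - g x| < eps)) := @compact_rV_ball R N L.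
case.
  move=> x _ /=.
  have e2 : 0 < eps / 2 by rewrite divr_gt0.
  have /cvgrPdist_lt /(_ _ e2) /nbhs_ballP [r /= r0 hr] := gc x.
  have r2 : 0 < r / 2 by rewrite divr_gt0.
  exists (ball x (r / 2), [set d | d < r / 2]) => /=.
    split; first exact: nbhsx_ballx.
    exact: nbhs_right_lt.
  move=> [x' d] /= [xx' dr] y yx'.
  have h1 : `|g x - g x'| < eps / 2.
    apply: hr; apply: le_ball xx'; lra.
  have h2 : `|g x - g y| < eps / 2.
    apply: hr; rewrite -ball_normE /= in xx' *.
    rewrite (_ : x - y = (x - x') - (y - x')); last by rewrite opprB addrA subrK.
    apply: le_lt_trans (ler_normB _ _) _; lra.
  rewrite (_ : g y - g x' = (g x - g x') - (g x - g y)); last by ring.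
  apply: le_lt_trans (ler_normB _ _) _; lra.
move=> d /= d0 h; exists (d / 2); first by rewrite divr_gt0.
move=> x y xL; apply: h => //=.
- rewrite sub0r normrN gtr0_norm; lra.
- lra.
Qed.

Lemma is_derive_line (R : realType) (N : nat) (f : 'rV[R]_N -> R) (v x : 'rV[R]_N) (t : R) :
  derivable f (x + t *: v) v ->
  is_derive t 1 (fun s => f (x + s *: v)) ('D_v f (x + t *: v)).
Proof.
move=> df.
have E : (fun h : R => h^-1 *: (((fun s => f (x + s *: v)) \o shift t) (h *: (1 : R^o)) - f (x + t *: v)))
       = (fun h => h^-1 *: ((f \o shift (x + t *: v)) (h *: v) - f (x + t *: v))).
  apply/funext => h /=; congr (_ *: (f _ - _)).
  by rewrite [h%:A]mulr1 scalerDl addrCA.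
by split; rewrite /derivable /derive E.
Qed.

Lemma MVT_line (R : realType) (N : nat) (f : 'rV[R]_N -> R) (v x : 'rV[R]_N) (h : R) :
  (forall y, derivable f y v) -> 0 < h ->
  exists2 t, 0 < t < h & f (x + h *: v) - f x = h * 'D_v f (x + t *: v).
Proof.
move=> df h0.
have [//||t] := @MVT R (fun s => f (x + s *: v)) (fun s => 'D_v f (x + s *: v)) 0 h h0.
- by move=> t _; exact: is_derive_line.
- apply: derivable_within_continuous => t _.
  by have [] := is_derive_line (df (x + t *: v)).
rewrite in_itv /= => t0h; rewrite subr0 scale0r addr0 mulrC => ->.
by exists t.
Qed.

Definition gridpt (R : realType) (N L n : nat)
    (k : {ffun 'I_N -> 'I_(2 * L * 2 ^ n).+1}) : 'rV[R]_N :=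
  \row_i ((k i)%:R / 2 ^+ n - L%:R).

Definition gridsum (R : realType) (N L n : nat) (g : 'rV[R]_N -> R) : R :=
  2 ^- (n * N) * \sum_(k : {ffun 'I_N -> 'I_(2 * L * 2 ^ n).+1}) g (gridpt R k).

Section Gridsum.
Variables (R : realType) (N : nat).
Implicit Types (L n j : nat) (g h Y : 'rV[R]_N -> R).

Lemma gridsumD L n g h :
  gridsum L n (fun x => g x + h x) = gridsum L n g + gridsum L n h.
Proof. by rewrite /gridsum big_split mulrDr. Qed.

Lemma gridsumZ L n c g : gridsum L n (fun x => c * g x) = c * gridsum L n g.
Proof. by rewrite /gridsum -mulr_sumr mulrCA. Qed.

Lemma gridsumB L n g h :
  gridsum L n (fun x => g x - h x) = gridsum L n g - gridsum L n h.
Proof. by rewrite /gridsum sumrB mulrBr. Qed.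

Lemma gridsum_sum L n (I : finType) (g : I -> 'rV[R]_N -> R) :
  gridsum L n (fun x => \sum_i g i x) = \sum_i gridsum L n (g i).
Proof. by rewrite /gridsum exchange_big mulr_sumr. Qed.

Lemma gridpt_norm L n k : `|@gridpt R N L n k| <= L%:R.
Proof.
apply: rV_norm_le => // i; rewrite mxE.
have h : (k i)%:R / 2 ^+ n <= 2 * L%:R :> R.
  rewrite ler_pdivrMr ?exprn_gt0 // -natrX -!natrM ler_nat.
  by rewrite -ltnS.
have h0 : 0 <= (k i)%:R / 2 ^+ n :> R by rewrite divr_ge0 // exprn_ge0.
rewrite ler_norml; apply/andP; split; lra.
Qed.

Lemma gridsum_le L n g h : (forall x, `|x| <= L%:R -> g x <= h x) ->
  gridsum L n g <= gridsum L n h.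
Proof.
move=> gh; apply: ler_wpM2l; first by rewrite invr_ge0 exprn_ge0.
by apply: ler_sum => k _; apply: gh; exact: gridpt_norm.
Qed.

Lemma eq_gridsum L n g h : (forall x, `|x| <= L%:R -> g x = h x) ->
  gridsum L n g = gridsum L n h.
Proof.
by move=> gh; apply/eqP; rewrite eq_le; apply/andP; split;
  apply: gridsum_le => x xL; rewrite gh.
Qed.

Lemma gridsum_cst_le L n (c : R) : 0 <= c ->
  gridsum L n (fun _ : 'rV[R]_N => c) <= c * (2 * L%:R + 1) ^+ N.
Proof.
move=> c0; rewrite /gridsum sumr_const card_ffun !card_ord -[c *+ _]mulr_natl mulrA mulrC.
apply: ler_wpM2l => //; rewrite exprM natrX -exprVn -exprMn.
apply: lerXn2r; rewrite ?nnegrE.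
- by rewrite mulr_ge0 // invr_ge0 exprn_ge0.
- by rewrite addr_ge0 // mulr_ge0.
- have e0 : 0 < 2 ^+ n :> R by rewrite exprn_gt0.
  rewrite -[(2 * L * 2 ^ n).+1%:R]natr1 !natrM natrX ler_pdivrMl // mulrDr mulr1 [2 ^+ n * _]mulrC lerD2l.
  by rewrite exprn_ege1 // ler1n.
Qed.

Lemma gridsum_norm_le L n g c : 0 <= c ->
  (forall x, `|x| <= L%:R -> `|g x| <= c) ->
  `|gridsum L n g| <= c * (2 * L%:R + 1) ^+ N.
Proof.
move=> c0 gc; apply: le_trans (gridsum_cst_le L n c0).
rewrite /gridsum normrM ger0_norm ?invr_ge0 ?exprn_ge0 //.
apply: ler_wpM2l; first by rewrite invr_ge0 exprn_ge0.
apply: le_trans (ler_norm_sum _ _ _) _.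
by apply: ler_sum => k _; apply: gc; exact: gridpt_norm.
Qed.

Lemma gridsum_shift L n j (i : 'I_N) g : (0 < L)%N -> (j <= n)%N ->
  (forall x, L%:R - 1 < `|x| -> g x = 0) ->
  gridsum L n (fun x => g (x + 2 ^- j *: delta_mx 0 i)) = gridsum L n g.
Proof.
move=> L0 jn g0; rewrite /gridsum; congr (_ * _).
set M := (2 * L * 2 ^ n)%N; pose c := (2 ^ (n - j))%N.
have cn : (c <= 2 ^ n)%N by rewrite leq_exp2l // leq_subr.
have cM : (c <= M)%N.
  by apply: leq_trans cn _; rewrite /M leq_pmull // muln_gt0.
have ce : 2 ^- j = c%:R / 2 ^+ n :> R.
  have e0 a : (2 : R) ^+ a != 0 by rewrite expf_neq0 // pnatr_eq0.
  by rewrite /c natrX -[in X in _ / X](subnK jn) exprD invfM mulrA divff // mul1r.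
pose d : {ffun 'I_N -> 'I_M.+1} := [ffun l => if l == i then inord c else 0].
rewrite [RHS](reindex_inj (@addIr _ d)) /=; apply: eq_bigr => k _.
have e0 : 0 < 2 ^+ n :> R by rewrite exprn_gt0.
have [kc|kc] := leqP (k i + c) M.
  congr g; apply/rowP => l; rewrite !mxE !ffunE eqxx /=.
  case: (eqVneq l i) => [->|_]; last by rewrite mulr0 addr0 addn0 modn_small.
  rewrite /= mulr1 inordK ?ltnS // modn_small ?ltnS // natrD ce; lra.
have ME : M%:R = 2 * L%:R * 2 ^+ n :> R by rewrite /M !natrM natrX.
rewrite !g0 //.
  apply: lt_le_trans (coord_norm_le _ i); rewrite mxE !ffunE eqxx /= inordK ?ltnS //.
  have -> : ((k i + c) %% M.+1 = k i + c - M.+1)%N.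
    rewrite -{1}(subnK kc) modnDr modn_small // ltn_subLR // addSn ltnS.
    by apply: leq_trans (leq_add (leq_ord (k i)) cM) _; rewrite addnS leqnSn.
  rewrite -normrN; apply: lt_le_trans (ler_norm _).
  suff : (k i + c - M.+1)%:R / 2 ^+ n < 1 :> R by lra.
  rewrite ltr_pdivrMr // mul1r -natrX ltr_nat.
  by rewrite ltn_subLR // addSn ltnS leq_add // -ltnS.
apply: lt_le_trans (coord_norm_le _ i); rewrite !mxE !eqxx /= mulr1 ce.
apply: lt_le_trans (ler_norm _).
suff : 2 * L%:R <= (k i)%:R / 2 ^+ n + c%:R / 2 ^+ n :> R by lra.
rewrite -mulrDl ler_pdivlMr // -ME -natrD ler_nat; exact: ltnW.
Qed.

End Gridsum.

(** * Functions with continuous partial derivatives *)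

Definition has_partials (R : realType) (N : nat) (f : 'rV[R]_N -> R)
    (df : 'I_N -> 'rV[R]_N -> R) : Prop :=
  continuous f /\ forall i, (forall x, is_derive x (delta_mx 0 i) f (df i x)) /\
    continuous (df i).

Lemma continuous_mul (T : topologicalType) (R : realType) (f g : T -> R) :
  continuous f -> continuous g -> continuous (fun x => f x * g x).
Proof. by move=> cf cg x; apply: (@continuousM _ _ f g x); [exact: cf|exact: cg]. Qed.

Lemma continuous_add (T : topologicalType) (R : realType) (f g : T -> R) :
  continuous f -> continuous g -> continuous (fun x => f x + g x).
Proof. by move=> cf cg x; apply: (@continuousD _ _ _ f g x); [exact: cf|exact: cg]. Qed.

Lemma continuous_sumf (T : topologicalType) (R : realType) (I : finType)
  (f : I -> T -> R) : (forall i, continuous (f i)) ->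
  continuous (fun x => \sum_i f i x).
Proof.
move=> cf; suff : forall s : seq I, continuous (fun x => \sum_(i <- s) f i x) by exact.
elim=> [|k s ih].
  have -> : (fun x => \sum_(k <- [::]) f k x) = (fun=> 0).
    by apply/funext => x; rewrite big_nil.
  exact: cst_continuous.
have -> : (fun x => \sum_(l <- k :: s) f l x)
    = (fun x => f k x + \sum_(l <- s) f l x).
  by apply/funext => x; rewrite big_cons.
exact: continuous_add.
Qed.

Section HasPartials.
Variables (R : realType) (N : nat).
Implicit Types (f g : 'rV[R]_N -> R) (df dg : 'I_N -> 'rV[R]_N -> R).

Lemma is_derive_lineP f (v x : 'rV[R]_N) (l : R) :
  is_derive x v f l <-> is_derive (0 : R) 1 (fun s => f (x + s *: v)) l.
Proof.
have E : (fun h : R => h^-1 *: (((fun s => f (x + s *: v)) \o shift 0) (h *: (1 : R^o)) - f (x + 0 *: v)))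
       = (fun h => h^-1 *: ((f \o shift x) (h *: v) - f x)).
  apply/funext => h /=; congr (_ *: (f _ - f _)).
    by rewrite [h%:A]mulr1 addr0 addrC.
  by rewrite scale0r addr0.
split=> -[h1 h2]; split; move: h1 h2; rewrite /derivable /derive E //.
Qed.

Lemma is_derive_compl (phi : R -> R) f (v x : 'rV[R]_N) (l r : R) :
  is_derive (f x) 1 phi r -> is_derive x v f l ->
  is_derive x v (fun y => phi (f y)) (r * l).
Proof.
move=> hphi /is_derive_lineP hf; apply/is_derive_lineP.
have hphi' : is_derive (f (x + (0 : R) *: v)) 1 phi r by rewrite scale0r addr0.
exact: (is_derive1_comp hphi' hf).
Qed.

Lemma eq_has_partials f g df dg : (forall x, f x = g x) ->
  (forall i x, df i x = dg i x) -> has_partials f df -> has_partials g dg.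
Proof.
move=> fg dfg; have -> : f = g by exact/funext.
by have -> : df = dg by apply/funext => i; exact/funext.
Qed.

Lemma has_partialsP f df : has_partials f df <->
  classC1 f /\ forall i x, partial_deriv i f x = df i x.
Proof.
split=> [[cf h]|[[cf h] e]].
  have e i : partial_deriv i f = df i.
    by apply/funext => x; rewrite /partial_deriv; have [/(_ x) [_ ->]] := h i.
  split; last by move=> i x; rewrite e.
  split=> // i; split; last by rewrite e; have [] := h i.
  by move=> x; have [/(_ x) []] := h i.
split=> // i; have <- : partial_deriv i f = df i by apply/funext => x.
by have [h1 h2] := h i; split=> // x.
Qed.

Lemma classC1_partials f : classC1 f -> has_partials f (fun i => partial_deriv i f).
Proof. by move=> cf; apply/has_partialsP. Qed.

Lemma has_partialsM f g df dg : has_partials f df -> has_partials g dg ->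
  has_partials (fun x => f x * g x) (fun i x => df i x * g x + f x * dg i x).
Proof.
move=> [cf hf] [cg hg]; split; first exact: continuous_mul.
move=> i; have [h1 h2] := hf i; have [h3 h4] := hg i; split=> [x|].
  have [d e] := is_deriveM (h1 x) (h3 x); split; first exact: d.
  by rewrite [LHS]e addrC; congr (_ + _); exact: mulrC.
by apply: continuous_add; apply: continuous_mul.
Qed.

Lemma has_partialsD f g df dg : has_partials f df -> has_partials g dg ->
  has_partials (fun x => f x + g x) (fun i x => df i x + dg i x).
Proof.
move=> [cf hf] [cg hg]; split; first exact: continuous_add.
move=> i; have [h1 h2] := hf i; have [h3 h4] := hg i; split=> [x|].
  exact: (is_deriveD (h1 x) (h3 x)).
exact: continuous_add.
Qed.

Lemma has_partials_cst (c : R) : has_partials (fun _ : 'rV[R]_N => c) (fun _ _ => 0).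
Proof.
split=> [|i]; first exact: cst_continuous.
split=> [x|]; last exact: cst_continuous.
exact: is_derive_cst.
Qed.

Lemma has_partials_sum (I : finType) (f : I -> 'rV[R]_N -> R)
    (dfs : I -> 'I_N -> 'rV[R]_N -> R) :
  (forall k, has_partials (f k) (dfs k)) ->
  has_partials (fun x => \sum_k f k x) (fun i x => \sum_k dfs k i x).
Proof.
move=> h.
suff : forall s : seq I, has_partials (fun x => \sum_(k <- s) f k x)
    (fun i x => \sum_(k <- s) dfs k i x) by exact.
elim=> [|k s ih].
  have -> : (fun x => \sum_(k <- [::]) f k x) = (fun=> 0).
    by apply/funext => x; rewrite big_nil.
  have -> : (fun i x => \sum_(k <- [::]) dfs k i x) = (fun _ _ => 0).
    by apply/funext => i; apply/funext => x; rewrite big_nil.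
  exact: has_partials_cst.
have -> : (fun x => \sum_(l <- k :: s) f l x)
    = (fun x => f k x + \sum_(l <- s) f l x).
  by apply/funext => x; rewrite big_cons.
have -> : (fun i x => \sum_(l <- k :: s) dfs l i x)
    = (fun i x => dfs k i x + \sum_(l <- s) dfs l i x).
  by apply/funext => i; apply/funext => x; rewrite big_cons.
exact: has_partialsD.
Qed.

Lemma continuous_comp_rV (phi : R -> R) f : (forall x, {for f x, continuous phi}) ->
  continuous f -> continuous (fun x => phi (f x)).
Proof. by move=> hphi cf x; apply: (@continuous_comp _ _ _ f phi x); [exact: cf|exact: hphi]. Qed.

Lemma has_partials_comp (phi phi' : R -> R) f df : has_partials f df ->
  (forall x, is_derive (f x) 1 phi (phi' (f x))) ->
  (forall x, {for f x, continuous phi'}) ->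
  has_partials (fun x => phi (f x)) (fun i x => phi' (f x) * df i x).
Proof.
move=> [cf hf] hphi cphi; split.
  apply: continuous_comp_rV => // x.
  by apply/differentiable_continuous/derivable1_diffP; have [] := hphi x.
move=> i; have [h1 h2] := hf i; split=> [x|]; first exact: is_derive_compl.
by apply: continuous_mul => //; exact: continuous_comp_rV.
Qed.

Lemma continuous_powR (a t : R) : 0 < t -> {for t, continuous (fun s : R => s `^ a)}.
Proof.
by move=> t0; apply/differentiable_continuous/derivable1_diffP; have [] := is_derive1_powR a t0.
Qed.

Lemma has_partials_powR a f df : has_partials f df -> (forall x, 0 < f x) ->
  has_partials (fun x => f x `^ a) (fun i x => a * f x `^ (a - 1) * df i x).
Proof.
move=> hf f0.
apply: (has_partials_comp (phi := fun s => s `^ a) (phi' := fun s => a * s `^ (a - 1))) => // x.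
  exact: is_derive1_powR.
by apply: (@continuousM _ _ (fun=> a)); [exact: cst_continuous|exact: continuous_powR].
Qed.

Lemma has_partials_shift (t : 'rV[R]_N) f df : has_partials f df ->
  has_partials (fun x => f (x - t)) (fun i x => df i (x - t)).
Proof.
have cs : continuous (fun x : 'rV[R]_N => x - t).
  by move=> x; apply: (@continuousB _ _ _ id (fun=> t)); [exact: cvg_id|exact: cst_continuous].
have comp g : continuous g -> continuous (fun x : 'rV[R]_N => g (x - t)).
  move=> cg x; have := @continuous_comp _ _ _ (fun y : 'rV[R]_N => y - t) g x (cs x) (cg (x - t)).
  by [].
move=> [cf hf]; split; first exact: comp.
move=> i; have [h1 h2] := hf i; split=> [x|]; last exact: comp.
  have /is_derive_lineP h := h1 (x - t); apply/is_derive_lineP.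
  by rewrite (_ : (fun s => _) = (fun s => f (x - t + s *: delta_mx 0 i))) //; apply/funext => s; rewrite addrAC.
Qed.

End HasPartials.

(** * Integration by parts for Riemann sums *)

Lemma pow2_small (R : realType) (d : R) : 0 < d ->
  exists J, forall j, (J <= j)%N -> 2 ^- j < d.
Proof.
move=> d0; have di : 0 <= d^-1 by rewrite invr_ge0 ltW.
exists (Num.bound d^-1) => j Jj.
rewrite -[d]invrK ltf_pV2 ?posrE ?invr_gt0 ?exprn_gt0 //.
apply: lt_le_trans (archi_boundP di) _.
rewrite -natrX ler_nat; apply: leq_trans Jj _.
exact/ltnW/ltn_expl.
Qed.

Section Ibp.
Variables (R : realType) (N : nat).
Implicit Types (L n j : nat) (f g b Y : 'rV[R]_N -> R).

Lemma derivable_diffquot f (i : 'I_N) (L : nat) eps : classC1 f -> 0 < eps ->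
  exists J, forall j, (J <= j)%N -> forall x, `|x| <= L%:R ->
  `|2 ^+ j * (f (x + 2 ^- j *: delta_mx 0 i) - f x) - partial_deriv i f x| <= eps /\
  `|2 ^+ j * (f x - f (x - 2 ^- j *: delta_mx 0 i)) - partial_deriv i f x| <= eps.
Proof.
move=> [_ /(_ i) [df cf]] e0.
have [d d0 hd] := unif_continuous_ball L%:R cf e0.
have [J hJ] := pow2_small d0.
exists J => j Jj x xL; have t0 : 0 < 2 ^- j :> R by rewrite invr_gt0 exprn_gt0.
have tn0 : 2 ^+ j != 0 :> R by rewrite expf_neq0.
have td := hJ _ Jj.
have small (s : R) : `|s| < d -> `|s *: delta_mx 0 i : 'rV[R]_N| < d.
  move=> sd; rewrite normrZ; apply: le_lt_trans sd.
  by rewrite ler_piMr // norm_delta_mx.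
split.
  have [t /andP [tp tl] ->] := MVT_line x df t0.
  rewrite mulrA divff // mul1r; apply: ltW; apply: (hd x) => //.
  rewrite addrAC subrr add0r; apply: small; rewrite gtr0_norm //; lra.
have [t /andP [tp tl]] := MVT_line (x - 2 ^- j *: delta_mx 0 i) df t0.
rewrite subrK => ->.
rewrite mulrA divff // mul1r; apply: ltW; apply: (hd x) => //.
rewrite addrAC [x - _]addrC addrK addrC -scalerBl.
by apply: small; rewrite ler0_norm; lra.
Qed.

Lemma cvg_gridsum0 L (g : 'rV[R]_N -> R) :
  (forall eps, 0 < eps -> exists n0, forall n, (n0 <= n)%N ->
     `|gridsum L n g| <= eps) -> gridsum L n g @[n --> \oo] --> 0.
Proof.
move=> h; apply/cvgrPdist_le => e e0; have [n0 hn] := h _ e0.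
by exists n0 => // n /= n0n; rewrite sub0r normrN; exact: hn.
Qed.

Lemma gridsum_ibp1 L (i : 'I_N) Y : (0 < L)%N -> classC1 Y ->
  (forall x, L%:R - 1 < `|x| -> Y x = 0) ->
  gridsum L n (partial_deriv i Y) @[n --> \oo] --> 0.
Proof.
move=> L0 cY Y0; apply: cvg_gridsum0 => e e0.
have D0 : 0 < (2 * L%:R + 1 : R) ^+ N by rewrite exprn_gt0 // ltr_wpDl // mulr_ge0.
have [J hJ] := derivable_diffquot i L cY (divr_gt0 e0 D0).
exists J => n Jn.
have E : gridsum L n (fun x => 2 ^+ J * (Y (x + 2 ^- J *: delta_mx 0 i) - Y x)) = 0.
  by rewrite gridsumZ gridsumB gridsum_shift // subrr mulr0.
rewrite -normrN -[- _]add0r -{1}E -gridsumB -[leRHS](divfK (lt0r_neq0 D0)).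
apply: gridsum_norm_le; first by rewrite ltW // divr_gt0.
by move=> x xL; have [] := hJ J (leqnn _) x xL.
Qed.

(* The symmetry of the integral of (d_i Y) (d_j b) in i and j only requires one
   derivative of b: the difference quotient of b in direction i is moved off Y
   before the derivative in direction j is. *)
Lemma gridsum_ibp2 L (i j : 'I_N) Y b : (0 < L)%N -> classC1 Y -> classC1 b ->
  (forall x, L%:R - 1 < `|x| -> Y x = 0) ->
  gridsum L n (fun x => partial_deriv i Y x * partial_deriv j b x
     - partial_deriv j Y x * partial_deriv i b x) @[n --> \oo] --> 0.
Proof.
move=> L0 cY cb Y0; apply: cvg_gridsum0 => e e0.
have D0 : 0 < (2 * L%:R + 1 : R) ^+ N by rewrite exprn_gt0 // ltr_wpDl // mulr_ge0.
have [_ /(_ j) [dYj cYj]] := cY.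
have [_ /(_ j) [dbj cbj]] := cb.
have [B1 B10 hB1] := continuous_bounded L%:R cYj.
have [B2 B20 hB2] := continuous_bounded L%:R cbj.
have BB0 : 0 < B1 + B2 + 1 by lra.
pose e1 := e / 3 / (2 * L%:R + 1 : R) ^+ N / (B1 + B2 + 1).
have e10 : 0 < e1 by rewrite !divr_gt0.
have [J1 hJ1] := derivable_diffquot i L cY e10.
have [J2 hJ2] := derivable_diffquot i L cb e10.
pose J := maxn J1 J2.
pose t : 'rV[R]_N := 2 ^- J *: delta_mx 0 i.
pose G x := Y x * (2 ^+ J * (b x - b (x - t))).
have hb := classC1_partials cb.
have /has_partialsP [cG1 dG'] := has_partialsM (classC1_partials cY)
  (has_partialsM (has_partials_cst N (2 ^+ J : R))
    (has_partialsD hb (has_partialsM (has_partials_cst N (-1 : R)) (has_partials_shift t hb)))).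
have GE : (fun x => Y x * (2 ^+ J * (b x + -1 * b (x - t)))) = G.
  by apply/funext => x; rewrite /G mulN1r.
rewrite GE in cG1 dG'.
have dG x : partial_deriv j G x = partial_deriv j Y x * (2 ^+ J * (b x - b (x - t)))
   + Y x * (2 ^+ J * (partial_deriv j b x - partial_deriv j b (x - t))).
  by rewrite dG'; ring.
have G0 x : L%:R - 1 < `|x| -> G x = 0 by move=> xL; rewrite /G Y0 // mul0r.
have e3 : 0 < e / 3 by lra.
have /cvgrPdist_le /(_ _ e3) [n1 _ hn1] := gridsum_ibp1 j L0 cG1 G0.
exists (maxn J n1) => n; rewrite geq_max => /andP [Jn n1n].
have {hn1} := hn1 n n1n; rewrite sub0r normrN => hn.
have shift : gridsum L n (fun x => 2 ^+ J * ((Y (x + t) - Y x) * partial_deriv j b x))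
  = gridsum L n (fun x => - (Y x * (2 ^+ J * (partial_deriv j b x - partial_deriv j b (x - t))))).
  have := @gridsum_shift R N L n J i (fun x => Y x * partial_deriv j b (x - t)) L0 Jn.
  rewrite -/t => h.
  rewrite (_ : (fun x => 2 ^+ J * _) = (fun x => 2 ^+ J * (Y (x + t) * partial_deriv j b (x + t - t)
      - Y x * partial_deriv j b x))); last by apply/funext => x; rewrite addrK mulrBl.
  rewrite gridsumZ gridsumB h; last by move=> x xL; rewrite Y0 // mul0r.
  rewrite -gridsumB -gridsumZ; congr gridsum; apply/funext => x; ring.
set lhs := gridsum _ _ _.
have -> : lhs = gridsum L n (fun x => (partial_deriv i Y x - 2 ^+ J * (Y (x + t) - Y x)) * partial_deriv j b x)
  + (gridsum L n (fun x => partial_deriv j Y x * (2 ^+ J * (b x - b (x - t)) - partial_deriv i b x))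
    - gridsum L n (partial_deriv j G)).
  have -> : gridsum L n (partial_deriv j G) = gridsum L n (fun x =>
     partial_deriv j Y x * (2 ^+ J * (b x - b (x - t)))) - gridsum L n (fun x => 2 ^+ J * ((Y (x + t) - Y x) * partial_deriv j b x)).
    rewrite shift -gridsumB; congr gridsum; apply/funext => x; rewrite dG; ring.
  rewrite -!gridsumB -gridsumD; congr gridsum; apply/funext => x; ring.
have bound (u v : 'rV[R]_N -> R) (B : R) : 0 <= B -> B <= B1 + B2 ->
    (forall x, `|x| <= L%:R -> `|u x| <= e1) -> (forall x, `|x| <= L%:R -> `|v x| <= B) ->
    `|gridsum L n (fun x => u x * v x)| <= e / 3.
  move=> B0 BB hu hv.
  have -> : e / 3 = (e1 * (B1 + B2 + 1)) * (2 * L%:R + 1) ^+ N.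
    by rewrite /e1; field; rewrite !lt0r_neq0.
  apply: gridsum_norm_le; first by rewrite mulr_ge0 ?ltW.
  move=> x xL; rewrite normrM; apply: ler_pM => //; first exact: hu.
  apply: le_trans (hv x xL) _; lra.
have h1 := bound _ _ B2 B20 _ _ hB2.
have h2 := bound _ (partial_deriv j Y) B1 B10 _ _ hB1.
apply: le_trans (ler_normD _ _) _.
apply: le_trans (lerD (lexx _) (ler_normB _ _)) _.
rewrite [leRHS](_ : _ = e / 3 + (e / 3 + e / 3)); last by field.
apply: lerD; first apply: h1.
- lra.
- move=> x xL; rewrite distrC; have [] := hJ1 J (leq_maxl _ _) x xL.
  by [].
- apply: lerD => //.
  rewrite (_ : (fun x => partial_deriv j Y x * _) = (fun x => (2 ^+ J * (b x - b (x - t)) - partial_deriv i b x) * partial_deriv j Y x)); last by apply/funext => x; rewrite mulrC.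
  apply: h2; first lra.
  by move=> x xL; have [] := hJ2 J (leq_maxr _ _) x xL.
Qed.

End Ibp.

(** * Second derivatives and powers of the gradient *)

Lemma partial_derivC (R : realType) (N : nat) (u : 'rV[R]_N -> R) (i j : 'I_N)
  (x : 'rV[R]_N) : classC2 u ->
  partial_deriv j (partial_deriv i u) x = partial_deriv i (partial_deriv j u) x.
Proof.
move=> [cu cdu].
set a := partial_deriv i u; set b := partial_deriv j u.
have mixed (k l : 'I_N) (h : R) : 0 < h -> exists y, `|y - x| <= h * 2 /\
    u (x + h *: delta_mx 0 k + h *: delta_mx 0 l) - u (x + h *: delta_mx 0 k)
     - u (x + h *: delta_mx 0 l) + u x = h ^+ 2 * partial_deriv l (partial_deriv k u) y.
  move=> h0; pose t : 'rV[R]_N := - (h *: delta_mx 0 l).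
  have /has_partialsP [[_ cF] dF] := has_partialsD (has_partials_shift t (classC1_partials cu))
    (has_partialsM (has_partials_cst N (-1 : R)) (classC1_partials cu)).
  have [s /andP [s0 sh]] := MVT_line x (cF k).1 h0.
  have dk := dF k (x + s *: delta_mx 0 k); rewrite /partial_deriv in dk; rewrite dk => E.
  have [r /andP [r0 rh] E2] := MVT_line (x + s *: delta_mx 0 k) ((cdu k).2 l).1 h0.
  exists (x + s *: delta_mx 0 k + r *: delta_mx 0 l); split.
    rewrite addrAC [x + _]addrC addrK mulr_natr mulr2n.
    apply: le_trans (ler_normD _ _) _; rewrite !normrZ !gtr0_norm //.
    have sm c (m : 'I_N) : 0 < c -> c < h -> c * `|delta_mx 0 m : 'rV[R]_N| <= h.
      by move=> c0 ch; apply: le_trans (ltW ch); rewrite ger_pMr // norm_delta_mx.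
    by apply: lerD; exact: sm.
  have -> : h ^+ 2 * partial_deriv l (partial_deriv k u) (x + s *: delta_mx 0 k + r *: delta_mx 0 l)
     = h * (partial_deriv k u (x + s *: delta_mx 0 k + h *: delta_mx 0 l) - partial_deriv k u (x + s *: delta_mx 0 k)).
    by rewrite E2 expr2 -mulrA.
  move: E; rewrite /t !opprK; rewrite -!/(partial_deriv _ _ _).
  move: (u (x + h *: delta_mx 0 k + h *: delta_mx 0 l)) (u (x + h *: delta_mx 0 k))
    (u (x + h *: delta_mx 0 l)) (u (x + s *: delta_mx 0 k)) (u x).
  move: (partial_deriv k u (x + s *: delta_mx 0 k + h *: delta_mx 0 l))
    (partial_deriv k u (x + s *: delta_mx 0 k)).
  clear => *; lra.
apply/eqP; rewrite -subr_eq0 -normr_le0; apply/ler_addgt0Pr => e e0.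
have e2 : 0 < e / 2 by rewrite divr_gt0.
have [d1 d10 h1] := unif_continuous_ball `|x| ((cdu i).2 j).2 e2.
have [d2 d20 h2] := unif_continuous_ball `|x| ((cdu j).2 i).2 e2.
pose h := Num.min d1 d2 / 3.
have d0 : 0 < Num.min d1 d2 by rewrite lt_min d10.
have h0 : 0 < h by rewrite divr_gt0.
have hd1 : h * 2 < d1.
  apply: (@lt_le_trans _ _ (Num.min d1 d2)); [rewrite /h; lra|by rewrite ge_min lexx].
have hd2 : h * 2 < d2.
  apply: (@lt_le_trans _ _ (Num.min d1 d2)); [rewrite /h; lra|by rewrite ge_min lexx orbT].
have [y [xy Ey]] := mixed i j h h0; have [z [xz Ez]] := mixed j i h h0.
have yz : partial_deriv j a y = partial_deriv i b z.
  have hn : h ^+ 2 != 0 by rewrite expf_neq0 // lt0r_neq0.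
  apply: (mulfI hn); move: Ey Ez.
  rewrite [x + h *: delta_mx 0 j + h *: delta_mx 0 i]addrAC.
  move: (u (x + h *: delta_mx 0 i + h *: delta_mx 0 j))
    (u (x + h *: delta_mx 0 i)) (u (x + h *: delta_mx 0 j)) (u x) => A B C D.
  move: (partial_deriv j a y) (partial_deriv i b z) => P Q; clear => *; lra.
have /(le_lt_trans xy) /(h1 x y (lexx _)) k1 := hd1.
have /(le_lt_trans xz) /(h2 x z (lexx _)) k2 := hd2.
rewrite yz in k1; rewrite add0r; move: k1 k2.
move: (partial_deriv i b z) (partial_deriv j a x) (partial_deriv i b x) => P Q S.
clear; rewrite !ltr_norml ler_norml => /andP[? ?] /andP[? ?].
by apply/andP; split; lra.
Qed.

Lemma powR_small (R : realType) (s eps : R) : 0 < s -> 0 < eps ->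
  exists2 d, 0 < d & forall t, 0 <= t -> t < d -> t `^ s < eps.
Proof.
move=> s0 e0; exists (eps `^ s^-1); first exact: powR_gt0.
move=> t t0 td; have -> : eps = (eps `^ s^-1) `^ s.
  by rewrite -powRrM mulVf ?lt0r_neq0 // powRr1 // ltW.
by apply: gt0_ltr_powR => //; rewrite nnegrE // powR_ge0.
Qed.

Lemma continuous_powR_ge0 (T : topologicalType) (R : realType) (f : T -> R) (s : R) :
  continuous f -> (forall x, 0 <= f x) -> 0 < s -> continuous (fun x => f x `^ s).
Proof.
move=> cf f0 s0 x; have [fx|fx] := eqVneq (f x) 0.
  apply/cvgrPdist_lt => e e0; have [d d0 hd] := powR_small s0 e0.
  have /cvgrPdist_lt /(_ _ d0) := cf x.
  apply: filterS => y; rewrite fx !sub0r !normrN powR0 ?lt0r_neq0 // sub0r normrN.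
  by rewrite !ger0_norm ?powR_ge0 //; exact: hd.
apply: (@continuous_comp _ _ _ f (fun t => t `^ s)); first exact: cf.
by apply: continuous_powR; rewrite lt0r fx f0.
Qed.

Lemma continuous_squeeze0 (T : topologicalType) (R : realType) (f b : T -> R) (x : T) :
  (forall y, `|f y| <= b y) -> b x = 0 -> {for x, continuous b} -> {for x, continuous f}.
Proof.
move=> fb bx cb; have fx : f x = 0.
  by apply/eqP; rewrite -normr_le0 -bx.
apply/cvgrPdist_lt => e e0; have /cvgrPdist_lt /(_ _ e0) := cb.
apply: filterS => y; rewrite fx bx !sub0r !normrN; apply: le_lt_trans.
by apply: le_trans (fb y) _; exact: ler_norm.
Qed.

Lemma is_derive_mul_vanish (R : realType) (N : nat) (f g : 'rV[R]_N -> R)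
  (x v : 'rV[R]_N) : {for x, continuous f} -> f x = 0 -> g x = 0 ->
  derivable g x v -> is_derive x v (fun y => f y * g y) 0.
Proof.
move=> cf fx gx dg.
have lim0 : (fun h : R => h^-1 *: (((fun y => f y * g y) \o shift x) (h *: v)
    - f x * g x)) @ 0^' --> (0 : R).
  have -> : (fun h : R => h^-1 *: (((fun y => f y * g y) \o shift x) (h *: v)
      - f x * g x)) = (fun h : R => f (h *: v + x) *
       (h^-1 *: ((g \o shift x) (h *: v) - g x))).
    by apply/funext => h; rewrite /= gx mulr0 !subr0 /GRing.scale /= mulrCA.
  rewrite -[X in _ --> X](mul0r ('D_v g x)); apply: cvgM; last exact: dg.
  have cl : {for (0 : R), continuous (fun h : R => f (h *: v + x))}.
    apply: (@continuous_comp _ _ _ (fun h : R => h *: v + x) f).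
      apply: (@continuousD _ _ _ (fun h : R => h *: v) (fun=> x)); last exact: cst_continuous.
      exact: scalel_continuous.
    by rewrite scale0r add0r.
  by move/continuous_withinNx: cl; rewrite scale0r add0r fx.
by split; [apply/cvg_ex; exists 0|exact: cvg_lim lim0].
Qed.

Section GradientPower.
Variables (R : realType) (N : nat) (u : 'rV[R]_N -> R).
Hypothesis cu : classC2 u.

Definition sqgrad (x : 'rV[R]_N) : R := \sum_i partial_deriv i u x ^+ 2.

Definition hessgrad (j : 'I_N) (x : 'rV[R]_N) : R :=
  \sum_i partial_deriv j (partial_deriv i u) x * partial_deriv i u x.

Lemma sqgrad_ge0 x : 0 <= sqgrad x.
Proof. by apply: sumr_ge0 => i _; exact: sqr_ge0. Qed.

Lemma has_partials_sqgrad : has_partials sqgrad (fun j x => 2 * hessgrad j x).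
Proof.
have [_ cdu] := cu.
apply: eq_has_partials (has_partials_sum (fun i =>
  has_partialsM (classC1_partials (cdu i)) (classC1_partials (cdu i)))) => [x|j x].
  by apply: eq_bigr => i _; rewrite expr2.
by rewrite /hessgrad mulr_sumr; apply: eq_bigr => i _; ring.
Qed.

Lemma partial_deriv_le_sqgrad i x : `|partial_deriv i u x| <= Num.sqrt (sqgrad x).
Proof.
rewrite -sqrtr_sqr ler_sqrt ?sqgrad_ge0 //.
by rewrite /sqgrad (bigD1 i) //= lerDl sumr_ge0 // => k _; exact: sqr_ge0.
Qed.

Lemma sqgrad_eq0 i x : sqgrad x = 0 -> partial_deriv i u x = 0.
Proof.
move=> z0; apply/eqP; rewrite -normr_le0.
by apply: le_trans (partial_deriv_le_sqgrad i x) _; rewrite z0 sqrtr0.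
Qed.

Lemma hessgrad_ratio_le (i j : 'I_N) x :
  `|hessgrad j x * partial_deriv i u x / sqgrad x|
    <= \sum_k `|partial_deriv j (partial_deriv k u) x|.
Proof.
have [z0|z0] := eqVneq (sqgrad x) 0.
  by rewrite z0 invr0 mulr0 normr0 sumr_ge0.
have zp : 0 < sqgrad x by rewrite lt0r z0 sqgrad_ge0.
rewrite normrM normfV (gtr0_norm zp) ler_pdivrMr // mulr_suml mulr_suml.
apply: le_trans (ler_norm_sum _ _ _) _; apply: ler_sum => k _.
rewrite -mulrA normrM; apply: ler_wpM2l => //.
rewrite normrM -[leRHS]sqr_sqrtr ?sqgrad_ge0 // expr2.
by apply: ler_pM => //; exact: partial_deriv_le_sqgrad.
Qed.

(* At a critical point of u the formula relies on 0 `^ 0 = 1 and x / 0 = 0. *)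
Lemma has_partials_gradpow (s : R) (i : 'I_N) : 0 <= s ->
  has_partials (fun x => sqgrad x `^ s * partial_deriv i u x)
   (fun j x => sqgrad x `^ s * (partial_deriv j (partial_deriv i u) x
       + 2 * s * (hessgrad j x * partial_deriv i u x / sqgrad x))).
Proof.
move=> s0; have [_ cdu] := cu.
have [cz dz] := has_partials_sqgrad.
have [cui dui] := classC1_partials (cdu i).
have [s00|sn0] := eqVneq s 0.
  apply: eq_has_partials (classC1_partials (cdu i)) => [x|j x].
    by rewrite s00 powRr0 mul1r.
  by rewrite s00 powRr0 mulr0 mul0r addr0 mul1r.
have sp : 0 < s by rewrite lt0r sn0.
have cpow : continuous (fun x => sqgrad x `^ s).
  by apply: continuous_powR_ge0 => // x; exact: sqgrad_ge0.
split; first exact: continuous_mul.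
move=> j; have [duij cuij] := dui j; have [dzj czj] := dz j.
have ckj : continuous (fun x => sqgrad x `^ s * (hessgrad j x * partial_deriv i u x / sqgrad x)).
  move=> x; have [zx|zx] := eqVneq (sqgrad x) 0.
    apply: (@continuous_squeeze0 _ _ _ (fun y => sqgrad y `^ s *
      \sum_k `|partial_deriv j (partial_deriv k u) y|)) => [y||].
    - by rewrite normrM (ger0_norm (powR_ge0 _ _)) ler_wpM2l ?powR_ge0 // hessgrad_ratio_le.
    - by rewrite zx powR0 // mul0r.
    - apply: (continuous_mul (f := fun y => sqgrad y `^ s)) => //.
      apply: continuous_sumf => k y; apply: continuous_comp; last exact: norm_continuous.
      exact: (((cdu k).2 j).2 y).
  apply: (@continuousM _ _ (fun y => sqgrad y `^ s)); first exact: cpow.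
  apply: (@continuousM _ _ (fun y => hessgrad j y * partial_deriv i u y)).
    apply: (continuous_mul (f := hessgrad j)) => // y.
    have -> : hessgrad j = (fun y => 2^-1 * (2 * hessgrad j y)).
      by apply/funext => w; rewrite mulrA mulVf ?mul1r.
    by apply: (continuous_mul (f := fun=> 2^-1)) => // w; exact: cst_continuous.
  by apply: continuousV => //; exact: cz.
split; last first.
  have -> : (fun x => sqgrad x `^ s * (partial_deriv j (partial_deriv i u) x
      + 2 * s * (hessgrad j x * partial_deriv i u x / sqgrad x)))
    = (fun x => sqgrad x `^ s * partial_deriv j (partial_deriv i u) x
      + 2 * s * (sqgrad x `^ s * (hessgrad j x * partial_deriv i u x / sqgrad x))).
    by apply/funext => x; ring.
  apply: continuous_add; first exact: continuous_mul.
  by apply: continuous_mul => // y; exact: cst_continuous.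
move=> x; have [zx|zx] := eqVneq (sqgrad x) 0.
  rewrite zx powR0 // mul0r.
  apply: is_derive_mul_vanish; first exact: cpow.
  - by rewrite zx powR0.
  - exact: sqgrad_eq0.
  - by have [] := duij x.
have zp : 0 < sqgrad x by rewrite lt0r zx sqgrad_ge0.
have [d1 d2] := is_deriveM (is_derive_compl (is_derive1_powR s zp) (dzj x)) (duij x).
split; first exact: d1.
rewrite [LHS]d2 /=.
have -> : sqgrad x `^ (s - 1) = sqgrad x `^ s / sqgrad x.
  by rewrite powRB ?powRr1 // ?sqgrad_ge0 // zx implybT.
rewrite /GRing.scale /=; move: (sqgrad x `^ s) (sqgrad x)^-1 => P Q; ring.
Qed.

End GradientPower.

(** * Cutoff functions and the Liouville scheme *)

Section Cutoff.
Variables (R : realType) (N : nat).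

Lemma is_derive_quadratic (phi : R -> R) (t d : R) :
  (forall h, `|phi (t + h) - phi t - h * d| <= h ^+ 2) -> is_derive t 1 phi d.
Proof.
move=> hq.
have lim0 : (fun h : R => h^-1 *: ((phi \o shift t) (h *: (1 : R^o)) - phi t)) @ 0^' --> d.
  apply/cvgrPdist_lt => e e0; near=> h.
  have hn0 : h != 0 by near: h; exact: nbhs_dnbhs_neq.
  have he : `|h| < e.
    near: h; apply: dnbhs0_lt; exact: e0.
  have -> : (phi \o shift t) (h *: (1 : R^o)) = phi (t + h).
    by rewrite /= [h%:A]mulr1 addrC.
  rewrite distrC /GRing.scale /=.
  have -> : h^-1 * (phi (t + h) - phi t) - d = h^-1 * (phi (t + h) - phi t - h * d).
    by rewrite [RHS]mulrBr mulrA mulVf // mul1r.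
  rewrite normrM normfV ltr_pdivrMl ?normr_gt0 //.
  apply: le_lt_trans (hq h) _.
  by rewrite -[h ^+ 2]real_normK ?num_real // expr2 ltr_pM2l ?normr_gt0.
by split; [apply/cvg_ex; exists d|exact: cvg_lim lim0].
Unshelve. all: by end_near. Qed.

Lemma is_derive_sqr_max0 (t : R) :
  is_derive t 1 (fun s => Num.max s 0 ^+ 2) (2 * Num.max t 0).
Proof.
apply: is_derive_quadratic => h; rewrite ler_norml.
have [t0|t0] := leP t 0; have [th|th] := leP (t + h) 0; apply/andP; split; nra.
Qed.

Lemma continuous_max0 : continuous (fun s : R => Num.max s 0).
Proof.
by move=> s; apply: continuous_max; [exact: cvg_id|exact: cst_continuous].
Qed.

Definition theta (rho : R) (x : 'rV[R]_N) : R :=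
  Num.max (1 - rho ^- 2 * \sum_i x 0 i ^+ 2) 0.

Lemma theta_ge0 rho x : 0 <= theta rho x.
Proof. by rewrite /theta le_max lexx orbT. Qed.

Lemma theta_le1 rho x : theta rho x <= 1.
Proof.
rewrite /theta ge_max ler01 andbT gerBl mulr_ge0 ?sumr_ge0 // => [|i _].
  by rewrite invr_ge0 sqr_ge0.
exact: sqr_ge0.
Qed.

Lemma coord_le_theta rho x i : 0 < rho -> 0 < theta rho x -> `|x 0 i| <= rho.
Proof.
move=> r0; rewrite /theta lt_max ltxx orbF subr_gt0 -[rho ^- 2 * _]mulrC.
rewrite ltr_pdivrMr ?exprn_gt0 // mul1r => h.
rewrite -(ler_pXn2r (n := 2)) ?nnegrE ?(ltW r0) //.
rewrite real_normK ?num_real //; apply: le_trans (ltW h).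
by rewrite (bigD1 i) //= lerDl sumr_ge0 // => k _; exact: sqr_ge0.
Qed.

Lemma theta_eq0 rho x : 0 < rho -> rho < `|x| -> theta rho x = 0.
Proof.
move=> r0 rx; apply/eqP; rewrite eq_le theta_ge0 andbT leNgt.
apply/negP => t0; move: rx; rewrite ltNge => /negP; apply.
by apply: rV_norm_le => [|i]; [exact: ltW|exact: coord_le_theta t0].
Qed.

Lemma theta_ge_half rho x (B : R) : 0 < rho -> `|x| <= B -> 2 * N%:R * B ^+ 2 <= rho ^+ 2 ->
  2^-1 <= theta rho x.
Proof.
move=> r0 xB hB; rewrite /theta le_max; apply/orP; left.
have h : rho ^- 2 * (\sum_i x 0 i ^+ 2) <= 2^-1.
  rewrite mulrC ler_pdivrMr ?exprn_gt0 //.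
  apply: (@le_trans _ _ (\sum_(i < N) B ^+ 2)).
    apply: ler_sum => i _; rewrite -[x 0 i ^+ 2]real_normK ?num_real //.
    by rewrite ler_pXn2r ?nnegrE // ?(le_trans (coord_norm_le x i)) // (le_trans _ xB).
  by rewrite sumr_const card_ord -mulr_natl; clear -hB; lra.
by clear -h; lra.
Qed.

Lemma has_partials_coord (i : 'I_N) :
  has_partials (fun x : 'rV[R]_N => x 0 i) (fun j _ => (i == j)%:R).
Proof.
split; first by move=> x; exact: coord_continuous.
move=> j; split=> [x|]; last exact: cst_continuous.
apply/is_derive_lineP.
have -> : (fun s : R => (x + s *: delta_mx 0 j) 0 i) = (fun s => x 0 i + s * (i == j)%:R).
  by apply/funext => s; rewrite !mxE eqxx.
apply: is_derive_quadratic => h.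
have -> : x 0 i + (0 + h) * (i == j)%:R - (x 0 i + 0 * (i == j)%:R) - h * (i == j)%:R = 0.
  by clear; ring.
by rewrite normr0 sqr_ge0.
Qed.

Lemma has_partialsX (f : 'rV[R]_N -> R) df k : has_partials f df ->
  has_partials (fun x => f x ^+ k.+1) (fun i x => k.+1%:R * f x ^+ k * df i x).
Proof.
move=> hf; elim: k => [|k ih].
  apply: eq_has_partials hf => [x|i x]; first by rewrite expr1.
  by rewrite expr0 !mul1r.
apply: eq_has_partials (has_partialsM hf ih) => [x|i x]; first by rewrite [RHS]exprS.
rewrite -[k.+2%:R]natr1 exprS; move: (f x) (df i x) (k.+1%:R) => a b c; ring.
Qed.

Lemma has_partials_theta rho k :
  has_partials (fun x => theta rho x ^+ (2 * k.+1))
    (fun j x => k.+1%:R * theta rho x ^+ (2 * k).+1 * (- 4 * rho ^- 2 * x 0 j)).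
Proof.
have h1 := has_partialsM (has_partials_cst N (- rho ^- 2))
  (has_partials_sum (fun i => has_partialsM (has_partials_coord i) (has_partials_coord i))).
have h2 := has_partialsD (has_partials_cst N (1 : R)) h1.
have cphi : continuous (fun s : R => 2 * Num.max s 0).
  apply: (continuous_mul (f := fun=> 2)); last exact: continuous_max0.
  by move=> s; exact: cst_continuous.
have h3 := has_partials_comp h2 (fun x => is_derive_sqr_max0 _) (fun x => cphi _).
apply: eq_has_partials (has_partialsX k h3) => [x|j x].
  rewrite exprM /theta; congr ((Num.max _ _ ^+ 2) ^+ _).
  by rewrite mulNr; congr (1 - _ * _); apply: eq_bigr => i _; rewrite expr2.
rewrite [theta rho x ^+ _]exprSr exprM /theta.
have -> : 1 + - rho ^- 2 * (\sum_k x 0 k * x 0 k) = 1 - rho ^- 2 * \sum_i x 0 i ^+ 2.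
  by rewrite mulNr; congr (1 - _ * _); apply: eq_bigr => i _; rewrite expr2.
have -> : \sum_(i < N) ((i == j)%:R * x 0 i + x 0 i * (i == j)%:R) = 2 * x 0 j.
  rewrite (bigD1 j) //= eqxx big1 => [|i /negPf ->]; last by rewrite mul0r mulr0 addr0.
  by rewrite mul1r mulr1 addr0 mulr2n mulrDl mul1r.
move: (Num.max (1 - rho ^- 2 * \sum_i x 0 i ^+ 2) 0) (x 0 j) (rho ^- 2) (k.+1%:R).
by move=> a b c d; ring.
Qed.

Lemma partial_theta_le rho k (j : 'I_N) x : 0 < rho ->
  `|k.+1%:R * theta rho x ^+ (2 * k).+1 * (- 4 * rho ^- 2 * x 0 j)|
    <= 4 * k.+1%:R / rho * theta rho x ^+ (2 * k).+1.
Proof.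
move=> r0; have t0 := theta_ge0 rho x.
have [->|tn0] := eqVneq (theta rho x) 0.
  by rewrite expr0n /= mulr0 mul0r normr0 mulr0.
have tp : 0 < theta rho x by rewrite lt0r tn0.
have xr := coord_le_theta j r0 tp.
rewrite !normrM normrN normfV !normr_nat (ger0_norm (exprn_ge0 _ t0)).
rewrite (ger0_norm (exprn_ge0 2 (ltW r0))).
have -> : 4 * k.+1%:R / rho * theta rho x ^+ (2 * k).+1
  = k.+1%:R * theta rho x ^+ (2 * k).+1 * (4 * rho ^- 2 * rho).
  by field; rewrite lt0r_neq0.
apply: ler_wpM2l; first by rewrite mulr_ge0 ?exprn_ge0.
by apply: ler_wpM2l => //; rewrite mulr_ge0 // invr_ge0 sqr_ge0.
Qed.

End Cutoff.

Lemma gridsum_lower (R : realType) (N L n J : nat) (g : 'rV[R]_N -> R)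
  (x0 : 'rV[R]_N) (r c : R) : (J <= n)%N -> 2 ^- J <= r -> 0 <= c ->
  `|x0| + r <= L%:R -> (forall x, 0 <= g x) ->
  (forall x, `|x - x0| <= r -> c <= g x) ->
  c * 2 ^- (J * N) <= gridsum L n g.
Proof.
move=> Jn Jr c0 xL g0 gc.
have e0 : 0 < 2 ^+ n :> R by rewrite exprn_gt0.
have r0 : 0 <= r by apply: le_trans Jr; rewrite invr_ge0 exprn_ge0.
have x0L i : 0 <= x0 0 i + L%:R /\ x0 0 i + r <= L%:R.
  have := coord_norm_le x0 i; rewrite ler_norml => /andP [h1 h2].
  by clear -h1 h2 xL r0; split; lra.
pose m := (2 ^ (n - J))%N.
have m0 : (0 < m)%N by rewrite expn_gt0.
have mE : m%:R / 2 ^+ n = 2 ^- J :> R.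
  have en a : (2 : R) ^+ a != 0 by rewrite expf_neq0 // pnatr_eq0.
  by rewrite /m natrX -[in X in _ / X](subnK Jn) exprD invfM mulrA divff // mul1r.
pose k0 i := Num.truncn ((x0 0 i + L%:R) * 2 ^+ n).
have k0P i : (k0 i)%:R / 2 ^+ n <= x0 0 i + L%:R < (k0 i)%:R / 2 ^+ n + 2 ^- n.
  have /truncn_itv /andP [h1 h2] : 0 <= (x0 0 i + L%:R) * 2 ^+ n.
    by rewrite mulr_ge0 ?(ltW e0) //; have [] := x0L i.
  have -> : (k0 i)%:R / 2 ^+ n + 2 ^- n = (k0 i).+1%:R / 2 ^+ n :> R.
    by rewrite -[(k0 i).+1%:R]natr1 mulrDl mul1r.
  by rewrite ler_pdivrMr // h1 /= ltr_pdivlMr.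
have bnd i a : (a < m)%N -> (k0 i + a < (2 * L * 2 ^ n).+1)%N.
  move=> am; rewrite ltnS -(ler_nat R) !natrM natrX -ler_pdivrMr // natrD mulrDl.
  have : a%:R / 2 ^+ n <= 2 ^- J :> R.
    by rewrite -mE ler_pM2r ?invr_gt0 // ler_nat ltnW.
  have /andP [h1 _] := k0P i; have [_ h2] := x0L i.
  by move: h1 h2 Jr; clear; move: ((k0 i)%:R / 2 ^+ n) (a%:R / 2 ^+ n) => A B *; lra.
pose F (a : {ffun 'I_N -> 'I_m}) : {ffun 'I_N -> 'I_(2 * L * 2 ^ n).+1} :=
  [ffun i => inord (k0 i + a i)].
have FE a i : F a i = (k0 i + a i)%N :> nat by rewrite ffunE inordK // bnd.
have injF : injective F.
  move=> a b /ffunP ab; apply/ffunP => i; apply/val_inj => /=.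
  by have := congr1 (@nat_of_ord _) (ab i); rewrite !FE => /addnI.
have Fclose a : `|gridpt R (F a) - x0| <= r.
  apply: rV_norm_le => // i; rewrite !mxE FE natrD mulrDl.
  have h3 : (a i)%:R / 2 ^+ n <= 2 ^- J :> R.
    by rewrite -mE ler_pM2r ?invr_gt0 // ler_nat ltnW.
  have h4 : 0 <= (a i)%:R / 2 ^+ n :> R by rewrite divr_ge0 ?(ltW e0).
  have h5 : 2 ^- n <= 2 ^- J :> R.
    by rewrite lef_pV2 ?posrE ?exprn_gt0 // ler_weXn2l // ler1n.
  have /andP [h1 h2] := k0P i; rewrite ler_norml; apply/andP.
  move: h1 h2 h3 h4 h5 Jr; clear; 
  move: ((k0 i)%:R / 2 ^+ n) ((a i)%:R / 2 ^+ n) => A B *.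
  split; lra.
apply: (@le_trans _ _ (2 ^- (n * N) * \sum_(a : {ffun 'I_N -> 'I_m}) g (gridpt R (F a)))).
  apply: (@le_trans _ _ (2 ^- (n * N) * \sum_(a : {ffun 'I_N -> 'I_m}) c)).
    rewrite sumr_const card_ffun !card_ord -[c *+ _]mulr_natl mulrA mulrC.
    rewrite [(m ^ N)%:R]natrX [2 ^+ (n * N)]exprM -[((2 ^+ n) ^+ N)^-1]exprVn -exprMn.
    by rewrite [(2 ^+ n)^-1 * _]mulrC mE exprVn -exprM.
  apply: ler_wpM2l; first by rewrite invr_ge0 exprn_ge0.
  by apply: ler_sum => a _; exact: gc.
apply: ler_wpM2l; first by rewrite invr_ge0 exprn_ge0.
have <- : \sum_(k in imset F (mem predT)) g (gridpt R k) = \sum_a g (gridpt R (F a)).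
  by rewrite big_imset => [|a b _ _]; [exact: eq_bigl|exact: injF].
rewrite [leRHS](bigID (mem (imset F (mem predT)))) /= lerDl.
by apply: sumr_ge0.
Qed.

Lemma powR_tendsto0 (R : realType) (a e : R) : 0 < a -> 0 < e ->
  exists k0 : nat, forall k : nat, (k0 <= k)%N -> k%:R `^ (- a) < e.
Proof.
move=> a0 e0; pose b := e^-1 `^ a^-1.
have b0 : 0 < b by rewrite powR_gt0 // invr_gt0.
exists (Num.bound b) => k bk.
have kb : b < k%:R by apply: lt_le_trans (archi_boundP (ltW b0)) _; rewrite ler_nat.
have k0 : 0 < k%:R :> R by exact: lt_trans kb.
rewrite powRN -[e]invrK ltf_pV2 ?posrE ?invr_gt0 ?powR_gt0 //.
have -> : e^-1 = b `^ a.
  by rewrite -powRrM mulVf ?lt0r_neq0 // powRr1 // invr_ge0 ltW.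
by apply: gt0_ltr_powR => //; rewrite nnegrE ltW.
Qed.

Lemma liouville_scheme (R : realType) (N K : nat) (g : 'rV[R]_N -> R)
  (Phi : nat -> 'rV[R]_N -> R) (C tau : R) :
  continuous g -> (forall x, 0 <= g x) -> N%:R < tau -> 0 <= C ->
  (forall rho, (0 < rho)%N -> gridsum (rho + 2) n (Phi rho) @[n --> \oo] --> 0) ->
  (forall rho, (0 < rho)%N -> forall x, 
     theta rho%:R x ^+ K * g x <= Phi rho x + C * rho%:R `^ (- tau)) ->
  forall x, g x = 0.
Proof.
move=> cg g0 tauN C0 Phi0 hPhi x0.
apply/eqP; rewrite eq_le g0 andbT leNgt; apply/negP => gx0.
pose c := g x0 / 2.
have c0 : 0 < c by rewrite divr_gt0.
have [d d0 hd] := unif_continuous_ball `|x0| cg c0.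
have [J hJ] := pow2_small d0.
have Jd : 2 ^- J < d by exact: hJ.
pose b := 2^-1 ^+ K * c * 2 ^- (J * N) / 2.
have b0 : 0 < b by rewrite !mulr_gt0 ?invr_gt0 ?exprn_gt0.
have key : exists rho1, forall rho, (rho1 <= rho)%N -> (0 < rho)%N -> 2 * b <= C * rho%:R `^ (- tau) * (2 * (rho + 2)%:R + 1) ^+ N.
  pose B := `|x0| + 1; have B0 : 0 <= B by rewrite addr_ge0.
  pose r := 2 ^- J : R.
  have r0 : 0 < r by rewrite invr_gt0 exprn_gt0.
  have r1 : r <= 1 by rewrite invf_le1 ?exprn_gt0 // exprn_ege1 // ler1n.
  pose S := 2 * N%:R * B ^+ 2 + B.
  have S0 : 0 <= S by rewrite addr_ge0 // mulr_ge0 ?sqr_ge0 // mulr_ge0.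
  exists (Num.bound S) => rho Sr rho0.
  have rhoS : S <= rho%:R.
    by apply: ltW; apply: lt_le_trans (archi_boundP S0) _; rewrite ler_nat.
  have rho1 : 1 <= rho%:R :> R by rewrite ler1n.
  have hb n : (J <= n)%N -> 2 * b <= gridsum (rho + 2) n (Phi rho)
       + C * rho%:R `^ (- tau) * (2 * (rho + 2)%:R + 1) ^+ N.
    move=> Jn.
    have -> : 2 * b = 2^-1 ^+ K * c * 2 ^- (J * N) by rewrite /b mulrC divfK.
    apply: (@le_trans _ _ (gridsum (rho + 2) n (fun x => theta rho%:R x ^+ K * g x))).
      apply: (@gridsum_lower _ _ _ _ _ _ x0 r) => //.
      - by rewrite mulr_ge0 ?(ltW c0) // exprn_ge0.
      - rewrite natrD; apply: (@le_trans _ _ B); first by rewrite lerD2l.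
        apply: (@le_trans _ _ S); first by rewrite lerDr mulr_ge0 ?sqr_ge0 // mulr_ge0.
        by apply: le_trans rhoS _; rewrite lerDl.
      - by move=> x; rewrite mulr_ge0 ?exprn_ge0 ?theta_ge0.
      - move=> x xr.
        have xB : `|x| <= B.
          rewrite -[x](subrK x0); apply: le_trans (ler_normD _ _) _.
          by rewrite addrC lerD2l; apply: le_trans xr r1.
        apply: ler_pM; [by rewrite exprn_ge0|exact: ltW| |].
          apply: lerXn2r; rewrite ?nnegrE ?theta_ge0 //.
          apply: (@theta_ge_half _ _ _ _ B) => //; first exact: lt_le_trans rho1.
          apply: (@le_trans _ _ S); first by rewrite lerDl.
          by apply: le_trans rhoS _; rewrite expr2 ler_peMl // ltW // (lt_le_trans _ rho1).
        have := hd x0 x (lexx _) (le_lt_trans xr Jd).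
        rewrite ltr_norml => /andP [+ _]; rewrite /c; move: (g x) (g x0).
        by clear => *; lra.
    apply: (@le_trans _ _ (gridsum (rho + 2) n (fun x => Phi rho x + C * rho%:R `^ (- tau)))).
      by apply: gridsum_le => x _; exact: hPhi.
    rewrite gridsumD lerD2l; apply: gridsum_cst_le.
    by rewrite mulr_ge0 ?powR_ge0.
  apply/ler_addgt0Pr => e e0.
  have /cvgrPdist_le /(_ _ e0) [n1 _ hn1] := Phi0 _ rho0.
  apply: le_trans (hb (maxn J n1) (leq_maxl _ _)) _.
  rewrite addrC lerD2l.
  have := hn1 (maxn J n1) (leq_maxr _ _); rewrite sub0r normrN.
  by apply: le_trans; exact: ler_norm.
have [rho1 h1] := key.
have tN : 0 < tau - N%:R by rewrite subr_gt0.
have C1 : 0 < C * 7 ^+ N + 1 by rewrite ltr_wpDl // mulr_ge0 // exprn_ge0.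
have [k0 hk0] := powR_tendsto0 tN (divr_gt0 b0 C1).
pose rho := maxn (maxn rho1 k0) 1.
have rp : (0 < rho)%N by rewrite leq_maxr.
have rr : 1 <= rho%:R :> R by rewrite ler1n.
have := h1 rho _ rp; rewrite !leq_max leqnn => /(_ isT).
apply/negP; rewrite -ltNge.
have h2 : C * rho%:R `^ (- tau) * (2 * (rho + 2)%:R + 1) ^+ N <= C * 7 ^+ N * rho%:R `^ (- (tau - N%:R)).
  have -> : rho%:R `^ (- (tau - N%:R)) = rho%:R `^ (- tau) * rho%:R ^+ N :> R.
    rewrite opprB addrC powRD ?powR_mulrn //.
    by apply/implyP => _; rewrite pnatr_eq0 -lt0n.
  have -> : C * 7 ^+ N * (rho%:R `^ (- tau) * rho%:R ^+ N) = C * rho%:R `^ (- tau) * (7 * rho%:R) ^+ N.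
    by rewrite exprMn mulrACA.
  apply: ler_wpM2l; first by rewrite mulr_ge0 ?powR_ge0.
  apply: lerXn2r; rewrite ?nnegrE ?addr_ge0 ?mulr_ge0 //.
  by rewrite natrD; move: rr; clear => *; lra.
apply: le_lt_trans h2 _.
have h3 := hk0 rho _; move: h3; rewrite /rho !leq_max leqnn orbT => /(_ isT); rewrite -/rho => h3.
apply: (@le_lt_trans _ _ ((C * 7 ^+ N + 1) * rho%:R `^ (- (tau - N%:R)))).
  by apply: ler_wpM2r; [exact: powR_ge0|rewrite lerDl].
rewrite mulrC -ltr_pdivlMr //; apply: lt_trans h3 _.
by rewrite ltr_pM2r ?invr_gt0 // mulr2n mulrDl mul1r ltrDl.
Qed.

(** * Exponents *)

Lemma young3 (R : realType) (al be si eps : R) :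
  0 <= al -> 0 <= be -> 0 < si -> al + be + si = 1 -> 0 < eps ->
  exists2 C, 0 <= C & forall x y t, 0 <= x -> 0 <= y -> 0 <= t ->
    x `^ al * y `^ be * t `^ si <= eps * (x + y) + C * t.
Proof.
move=> al0 be0 si0 s1 e0.
pose c := (eps^-1) `^ si^-1.
have c0 : 0 < c by rewrite powR_gt0 // invr_gt0.
exists (eps * c); first by rewrite mulr_ge0 // ltW.
move=> x y t x0 y0 t0.
have ct0 : 0 <= c * t by rewrite mulr_ge0 // ltW.
pose M := x + y + c * t.
have M0 : 0 <= M by rewrite !addr_ge0.
have -> : eps * (x + y) + eps * c * t = eps * M by rewrite /M [RHS]mulrDr mulrA.
have [M00|Mn0] := eqVneq M 0.
  have t00 : c * t = 0.
    apply/eqP; rewrite eq_le ct0 andbT -M00 /M lerDr addr_ge0 //.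
  have -> : t = 0 by move/eqP: t00; rewrite mulf_eq0 (negPf (lt0r_neq0 c0)) /= => /eqP.
  by rewrite powR0 ?lt0r_neq0 // mulr0 M00 mulr0.
have -> : t `^ si = eps * (c * t) `^ si.
  rewrite powRM ?(ltW c0) // -powRrM mulVf ?lt0r_neq0 // powRr1 ?invr_ge0 ?(ltW e0) //.
  by rewrite mulrA divff ?mul1r // lt0r_neq0.
rewrite mulrCA ler_pM2l //.
have -> : M = M `^ al * M `^ be * M `^ si.
  by rewrite -!powRD ?Mn0 ?implybT // s1 powRr1.
have xM : x <= M by rewrite /M -addrA lerDl addr_ge0.
have yM : y <= M by rewrite /M addrAC lerDr addr_ge0.
have tM : c * t <= M by rewrite /M lerDr addr_ge0.
apply: ler_pM; rewrite ?mulr_ge0 ?powR_ge0 //.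
  by apply: ler_pM; rewrite ?powR_ge0 // ge0_ler_powR ?nnegrE.
by rewrite ge0_ler_powR ?nnegrE ?(ltW si0).
Qed.

Lemma young_weight (R : realType) (K l : nat) (b c b1 c1 b2 c2 al be si eps : R) :
  0 <= al -> 0 <= be -> 0 < si -> al + be + si = 1 -> 0 < eps ->
  b = al * b1 + be * b2 -> c = al * c1 + be * c2 -> c != 0 -> (0 < l)%N ->
  K%:R * (1 - si) <= l%:R ->
  exists2 C, 0 <= C & forall U Z th r, 0 < U -> 0 <= Z -> 0 <= th -> th <= 1 -> 0 <= r ->
    U `^ b * Z `^ c * th ^+ l * r `^ si
      <= eps * (th ^+ K * (U `^ b1 * Z `^ c1 + U `^ b2 * Z `^ c2)) + C * r.
Proof.
move=> al0 be0 si0 s1 e0 eb ec cn0 l0 lK.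
have [C C0 hC] := young3 al0 be0 si0 s1 e0.
exists C => // U Z th r U0 Z0 th0 th1 r0.
have Un : U != 0 by rewrite lt0r_neq0.
have [->|Zn] := eqVneq Z 0.
  rewrite (powR0 cn0) mulr0 !mul0r addr_ge0 // mulr_ge0 ?(ltW e0) //.
  by rewrite mulr_ge0 ?exprn_ge0 ?addr_ge0 // mulr_ge0 ?powR_ge0.
have [->|thn] := eqVneq th 0.
  rewrite expr0n gtn_eqF // mulr0 mul0r addr_ge0 // mulr_ge0 ?(ltW e0) //.
  by rewrite mulr_ge0 ?exprn_ge0 ?addr_ge0 // mulr_ge0 ?powR_ge0.
have thp : 0 < th by rewrite lt0r thn.
rewrite [th ^+ K * _]mulrDr.
have X0 d d' : 0 <= th ^+ K * (U `^ d * Z `^ d').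
  by rewrite mulr_ge0 ?exprn_ge0 // mulr_ge0 ?powR_ge0.
apply: le_trans (hC _ _ r (X0 b1 c1) (X0 b2 c2) r0).
apply: ler_wpM2r; first exact: powR_ge0.
have E d d' g : (th ^+ K * (U `^ d * Z `^ d')) `^ g
   = th `^ (K%:R * g) * (U `^ (d * g) * Z `^ (d' * g)).
  rewrite !powRM ?exprn_ge0 ?mulr_ge0 ?powR_ge0 // -!powRrM.
  by rewrite -powR_mulrn // -powRrM.
rewrite !E.
have -> : th `^ (K%:R * al) * (U `^ (b1 * al) * Z `^ (c1 * al)) *
   (th `^ (K%:R * be) * (U `^ (b2 * be) * Z `^ (c2 * be)))
  = U `^ b * Z `^ c * (th `^ (K%:R * al) * th `^ (K%:R * be)).
  rewrite eb ec (mulrC al) (mulrC be) (mulrC al) (mulrC be) !powRD ?Un ?Zn ?implybT //.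
  move: (U `^ (b1 * al)) (U `^ (b2 * be)) (Z `^ (c1 * al)) (Z `^ (c2 * be)) (th `^ (K%:R * al)) (th `^ (K%:R * be)).
  by clear => *; ring.
apply: ler_wpM2l; first by rewrite mulr_ge0 ?powR_ge0.
rewrite -powRD ?thn ?implybT // -powR_mulrn //.
apply: ger_powR; first by rewrite thp.
by rewrite -mulrDr; apply: le_trans lK; rewrite -s1 addrK.
Qed.

Lemma easy_exponents (R : realType) (N : nat) (p q : R) : (2 <= N)%N ->
  0 <= p -> 0 <= q -> q < 2 -> (N%:R - 2) * p + (N%:R - 1) * q < N%:R ->
  exists s al be si : R, [/\ 0 < s, 0 <= al, 0 <= be & 0 < si] /\
   [/\ al + be + si = 1, N%:R * si < 1, 2^-1 = al + be * (q / 2)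
     & - s = al * (- s - 1) + be * (p - s)].
Proof.
move=> N2 p0 q0 q2 sub.
have n2 : 2 <= N%:R :> R by rewrite (ler_nat R 2 N).
have n0 : 0 < N%:R :> R by lra.
have c0 : 0 < 2 - q by lra.
have cn : 2 - q != 0 by exact: lt0r_neq0.
have build (s si : R) : 0 < s -> 0 < si -> N%:R * si < 1 ->
    si * (s * (2 - q) - (2 * p + q)) = 1 - p - q ->
  exists s al be si : R, [/\ 0 < s, 0 <= al, 0 <= be & 0 < si] /\
   [/\ al + be + si = 1, N%:R * si < 1, 2^-1 = al + be * (q / 2)
     & - s = al * (- s - 1) + be * (p - s)].
  move=> s0 si0 Nsi e.
  have si2 : 2 * si < 1 by apply: le_lt_trans Nsi; rewrite ler_pM2r.
  pose be := (1 - 2 * si) / (2 - q).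
  have be0 : 0 <= be by rewrite divr_ge0 //; lra.
  have beE : be * (2 - q) = 1 - 2 * si by rewrite divfK.
  exists s, (be * p + s * si), be, si; split; first split => //.
    by rewrite addr_ge0 // mulr_ge0 // ltW.
  have key : be * p + s * si + be + si = 1.
    apply: (mulIf cn).
    have -> : (be * p + s * si + be + si) * (2 - q) = (be * (2 - q)) * (p + 1) + (s * si + si) * (2 - q) by ring.
    by rewrite beE; clear -e; lra.
  have k2 : be * p + s * si + be = 1 - si by rewrite -key addrK.
  split => //; first by clearbody be; clear -beE key; lra.
  have -> : (be * p + s * si) * (- s - 1) + be * (p - s)
    = - s * (be * p + s * si + be) - s * si by clear; ring.
  by rewrite k2; clear; ring.
have n1 : 0 < (N%:R + 1)^-1 :> R by rewrite invr_gt0; lra.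
have n1n : N%:R * (N%:R + 1)^-1 < 1 :> R by rewrite ltr_pdivrMr; lra.
have n1E : (N%:R + 1)^-1 * (N%:R + 1) = 1 :> R by rewrite mulVf // lt0r_neq0; lra.
have [pq|pq|pq] := ltgtP (p + q) 1.
- pose D := (N%:R + 1) * (1 - p - q).
  have D0 : 0 < D by rewrite mulr_gt0 //; lra.
  apply: (build ((D + (2 * p + q)) / (2 - q)) (N%:R + 1)^-1) => //.
    by rewrite divr_gt0 //; lra.
  by rewrite divfK // addrK /D mulrA n1E mul1r.
- pose gap := 2 * p + q - N%:R * (p + q - 1).
  have g0 : 0 < gap by rewrite /gap; clear -sub; lra.
  have d0 : 0 < 2 * p + q - gap / 2.
    have : 0 < N%:R * (p + q - 1) by rewrite mulr_gt0 //; lra.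
    by rewrite /gap; clear -g0; move: g0; rewrite /gap => *; lra.
  apply: (build (gap / 2 / (2 - q)) ((p + q - 1) / (2 * p + q - gap / 2))).
  + by rewrite !divr_gt0.
  + by rewrite divr_gt0 //; lra.
  + by rewrite mulrA ltr_pdivrMr // mul1r; rewrite /gap in g0 *; lra.
  + rewrite divfK // mulrC -[gap / 2 - _]opprB mulNr mulrC divfK ?lt0r_neq0 //.
    by clear; ring.
- apply: (build 1 (N%:R + 1)^-1) => //.
  have -> : 1 * (2 - q) - (2 * p + q) = 0 by clear -pq; lra.
  by rewrite mulr0; clear -pq; lra.
Qed.

Lemma main_exponents (R : realType) (N : nat) (p q e a : R) :
  0 <= p -> 0 <= q -> q < 2 -> 1 < p + q -> 0 <= e -> a <= 0 -> 0 < a + 2 * e + 2 ->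
  (N%:R - 4 - 2 * e) * (p + q - 1) < (2 - q) * (a + 2 * e + 2) ->
  exists al be si : R, [/\ 0 <= al, 0 <= be & 0 < si] /\ [/\ al + be + si = 1, N%:R * si < 2, e + 1 = al * (e + 2) + be * (e + q)
     & a = al * (a - 2) + be * (a + 2 * p)].
Proof.
move=> p0 q0 q2 pq e0 a0 h1 h2.
pose B := (2 - q) * (a + 2 * e + 2) + 2 * (e + 2) * (p + q - 1).
have B0 : 0 < B.
  rewrite /B addr_gt0 // ?mulr_gt0 //; lra.
have Bn : B != 0 by exact: lt0r_neq0.
pose si := 2 * (p + q - 1) / B; pose be := (a + 2 * e + 2) / B.
have si0 : 0 < si by rewrite divr_gt0 //; lra.
have be0 : 0 <= be by rewrite divr_ge0 // ltW.
exists (p * be - a * si / 2), be, si; split; first split => //.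
  by rewrite subr_ge0; apply: (@le_trans _ _ 0); [rewrite -mulrA mulr_le0_ge0 // divr_ge0 ?(ltW si0)|rewrite mulr_ge0].
have EB : B = (2 - q) * (a + 2 * e + 2) + 2 * (e + 2) * (p + q - 1) by [].
split.
- rewrite /si /be; apply: (mulIf Bn); rewrite mul1r [RHS]EB.
  have -> : (p * ((a + 2 * e + 2) / B) - a * (2 * (p + q - 1) / B) / 2 + (a + 2 * e + 2) / B + 2 * (p + q - 1) / B) * B
    = (p * (a + 2 * e + 2) - a * (p + q - 1) + (a + 2 * e + 2) + 2 * (p + q - 1)) * (B / B) by clear -Bn; field.
  by rewrite divff // mulr1; clear; ring.
- rewrite /si mulrA ltr_pdivrMr // /B; clear -h2; lra.
- rewrite /si /be; apply: (mulIf Bn); rewrite [in LHS]EB.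
  have -> : ((p * ((a + 2 * e + 2) / B) - a * (2 * (p + q - 1) / B) / 2) * (e + 2) + (a + 2 * e + 2) / B * (e + q)) * B
    = ((p * (a + 2 * e + 2) - a * (p + q - 1)) * (e + 2) + (a + 2 * e + 2) * (e + q)) * (B / B) by clear -Bn; field.
  by rewrite divff // mulr1; clear; ring.
- rewrite /si /be; apply: (mulIf Bn); rewrite [in LHS]EB.
  have -> : ((p * ((a + 2 * e + 2) / B) - a * (2 * (p + q - 1) / B) / 2) * (a - 2) + (a + 2 * e + 2) / B * (a + 2 * p)) * B
    = ((p * (a + 2 * e + 2) - a * (p + q - 1)) * (a - 2) + (a + 2 * e + 2) * (a + 2 * p)) * (B / B) by clear -Bn; field.
  by rewrite divff // mulr1; clear; ring.
Qed.

(** * Pointwise inequalities *)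

Lemma min_pos3 (R : realFieldType) (a b c : R) : 0 < a -> 0 < b -> 0 < c ->
  exists d, [/\ 0 < d, d <= a, d <= b & d <= c].
Proof.
move=> a0 b0 c0; exists (Num.min a (Num.min b c)).
by split; rewrite ?lt_min ?a0 ?b0 ?c0 // !ge_min lexx ?orbT.
Qed.

Lemma complete_square (R : realFieldType) (M B D g h l A f w : R) : M != 0 ->
  M * (A + B / (2 * M) * f + D / (2 * M) * w) ^+ 2 + (g - B ^+ 2 / (4 * M)) * f ^+ 2
    + (h - D ^+ 2 / (4 * M)) * w ^+ 2 + (l - B * D / (2 * M)) * (f * w)
  = M * A ^+ 2 + g * f ^+ 2 + h * w ^+ 2 + B * (A * f) + D * (A * w) + l * (f * w).
Proof. by move=> Mn; field. Qed.

Lemma good_params_coercive (R : realFieldType) (m p q e a k s : R) : 1 <= m ->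
  good_params m p q e a k s ->
  exists2 d, 0 < d & forall A f w H2 B2, 0 <= f -> 0 <= w ->
   A ^+ 2 + (f + A) ^+ 2 / m <= H2 -> A ^+ 2 <= B2 ->
   d * (H2 + f ^+ 2 + w ^+ 2) <=
   H2 - f ^+ 2 + a * w * (A + f) + 2 * e * (B2 + f * A)
   - k * ((a + p) * f * w + (2 * e + q) * f * A - f ^+ 2)
   - s * ((a - 1) * w ^+ 2 + 2 * (e + 1) * A * w - f * w).
Proof.
move=> m1 [[e0 _ _ _] []].
set M := (m + 1) / m + 2 * e; set B := _ - k * _; set D := a - _ => hF hW hK.
have m0 : 0 < m by lra.
have mn : m != 0 by exact: lt0r_neq0.
have M0 : 0 < M by rewrite /M ltr_pwDl ?divr_gt0 //; lra.
have Mn : M != 0 by exact: lt0r_neq0.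
pose F := (k - (m - 1) / m) - B ^+ 2 / (4 * M).
pose W := s * (1 - a) - D ^+ 2 / (4 * M).
pose K := (a - k * (a + p) + s) - B * D / (2 * M).
have M4 : 0 < 4 * M by rewrite mulr_gt0.
have M2 : 0 < 2 * M by rewrite mulr_gt0.
have F0 : 0 < F by rewrite /F subr_gt0 ltr_pdivrMr // [ltRHS]mulrC.
have W0 : 0 < W by rewrite /W subr_gt0 ltr_pdivrMr // [ltRHS]mulrC.
have K0 : 0 <= K by rewrite /K subr_ge0 ler_pdivrMr // [leRHS]mulrC.
pose b := B / (2 * M); pose c := D / (2 * M).
have fb0 : 0 < 9 * b ^+ 2 + 3 by rewrite ltr_wpDl // mulr_ge0 // sqr_ge0.
have wc0 : 0 < 9 * c ^+ 2 + 1 by rewrite ltr_wpDl // mulr_ge0 // sqr_ge0.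
have [d [d0 dM dF dW]] := min_pos3 (divr_gt0 M0 (ltr0n R 9)) (divr_gt0 F0 fb0) (divr_gt0 W0 wc0).
rewrite ler_pdivlMr // in dM; rewrite !ler_pdivlMr // in dF dW.
have [d' [d'0 d'd d'1 _]] := min_pos3 d0 (@ltr01 R) (@ltr01 R).
exists d' => // A f w H2 B2 f0 w0 hH hB.
pose X := A + b * f + c * w.
have form : (A ^+ 2 + (f + A) ^+ 2 / m) - f ^+ 2 + a * w * (A + f) + 2 * e * (A ^+ 2 + f * A)
   - k * ((a + p) * f * w + (2 * e + q) * f * A - f ^+ 2)
   - s * ((a - 1) * w ^+ 2 + 2 * (e + 1) * A * w - f * w)
   = M * X ^+ 2 + F * f ^+ 2 + W * w ^+ 2 + K * (f * w).
  have -> : M * X ^+ 2 + F * f ^+ 2 + W * w ^+ 2 + K * (f * w) =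
    M * A ^+ 2 + (k - (m - 1) / m) * f ^+ 2 + s * (1 - a) * w ^+ 2
    + B * (A * f) + D * (A * w) + (a - k * (a + p) + s) * (f * w).
    exact: complete_square.
  by rewrite /M /B /D; clear -mn; field.
have d'M : 0 <= M - 9 * d' by lra.
have d'F : 0 <= F - d' * (9 * b ^+ 2 + 3).
  by rewrite subr_ge0; apply: le_trans dF; rewrite ler_pM2r.
have d'W : 0 <= W - d' * (9 * c ^+ 2 + 1).
  by rewrite subr_ge0; apply: le_trans dW; rewrite ler_pM2r.
have A3 : A ^+ 2 <= 3 * X ^+ 2 + 3 * b ^+ 2 * f ^+ 2 + 3 * c ^+ 2 * w ^+ 2.
  have -> : A = X - b * f - c * w by rewrite /X; clear; ring.
  rewrite -subr_ge0.
  have -> : 3 * X ^+ 2 + 3 * b ^+ 2 * f ^+ 2 + 3 * c ^+ 2 * w ^+ 2 - (X - b * f - c * w) ^+ 2 =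
    (X + b * f) ^+ 2 + (X + c * w) ^+ 2 + (b * f - c * w) ^+ 2 by clear; ring.
  by rewrite !addr_ge0 ?sqr_ge0.
have fA : (f + A) ^+ 2 / m <= 2 * f ^+ 2 + 2 * A ^+ 2.
  rewrite ler_pdivrMr //.
  have h1 := sqr_ge0 (f - A); have h2 : 0 <= (2 * f ^+ 2 + 2 * A ^+ 2) * (m - 1).
    apply: mulr_ge0; last by move: m1; clear => m1; lra.
    by apply: addr_ge0; apply: mulr_ge0 => //; exact: sqr_ge0.
  by move: h1 h2; clear; move=> h1 h2; lra.
have main : d' * (A ^+ 2 + (f + A) ^+ 2 / m + f ^+ 2 + w ^+ 2) <=
   M * X ^+ 2 + F * f ^+ 2 + W * w ^+ 2 + K * (f * w).
  apply: (@le_trans _ _ (d' * (9 * X ^+ 2 + (9 * b ^+ 2 + 3) * f ^+ 2 + (9 * c ^+ 2 + 1) * w ^+ 2))).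
    rewrite ler_pM2l //; move: A3 fA; clear; move: (_ / m) => g A3 fA; lra.
  have h1 := mulr_ge0 d'M (sqr_ge0 X).
  have h2 := mulr_ge0 d'F (sqr_ge0 f).
  have h3 := mulr_ge0 d'W (sqr_ge0 w).
  have h4 := mulr_ge0 K0 (mulr_ge0 f0 w0).
  by move: h1 h2 h3 h4; clear; move=> *; lra.
rewrite -form in main.
have h1 : 0 <= (1 - d') * (H2 - (A ^+ 2 + (f + A) ^+ 2 / m)).
  by rewrite mulr_ge0 // subr_ge0.
have h2 : 0 <= e * (B2 - A ^+ 2) by rewrite mulr_ge0 // subr_ge0.
by move: main h1 h2; clear; move: (_ / m) => g *; lra.
Qed.

Lemma hessian_trace_ge (R : realFieldType) (N : nat) (H : 'I_N -> 'I_N -> R)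
  (xi : 'I_N -> R) (z A tr : R) : (2 <= N)%N ->
  z = \sum_i xi i ^+ 2 -> z != 0 -> tr = \sum_i H i i ->
  A * z = \sum_i \sum_j H i j * (xi i * xi j) ->
  A ^+ 2 + (tr - A) ^+ 2 / (N%:R - 1) <= \sum_i \sum_j H i j ^+ 2.
Proof.
move=> N2 ez zn etr eA.
have n1 : N%:R - 1 != 0 :> R.
  by apply: lt0r_neq0; rewrite subr_gt0 ltr1n.
pose l := (tr - A) / (N%:R - 1).
pose P i j := xi i * xi j / z.
pose dl (i j : 'I_N) : R := (i == j)%:R.
have sP : \sum_i \sum_j P i j ^+ 2 = 1.
  have -> : \sum_i \sum_j P i j ^+ 2 = \sum_i (xi i ^+ 2 * (z / z ^+ 2)).
    apply: eq_bigr => i _; rewrite [z in z / _]ez mulr_suml mulr_sumr.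
    by apply: eq_bigr => j _; rewrite /P; clear -zn; field.
  by rewrite -mulr_suml -ez; clear -zn; field.
have sHP : \sum_i \sum_j H i j * P i j = A.
  apply: (mulIf zn); rewrite eA mulr_suml; apply: eq_bigr => i _.
  by rewrite mulr_suml; apply: eq_bigr => j _; rewrite /P; clear -zn; field.
have sd (G : 'I_N -> 'I_N -> R) : \sum_i \sum_j G i j * dl i j = \sum_i G i i.
  apply: eq_bigr => i _; rewrite (bigD1 i) //= /dl eqxx mulr1 big1 ?addr0 // => j ji.
  by rewrite eq_sym (negPf ji) mulr0.
have sPd : \sum_i \sum_j P i j * dl i j = 1.
  rewrite sd /P -mulr_suml; have -> : \sum_i xi i * xi i = z; last exact: divff.
  by rewrite ez; apply: eq_bigr => i _; rewrite expr2.
have sdd : \sum_i \sum_j dl i j * dl i j = N%:R.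
  rewrite sd (eq_bigr (fun=> 1)) => [|i _]; last by rewrite /dl eqxx.
  by rewrite sumr_const card_ord.
have : 0 <= \sum_i \sum_j (H i j - (A - l) * P i j - l * dl i j) ^+ 2.
  by apply: sumr_ge0 => i _; apply: sumr_ge0 => j _; exact: sqr_ge0.
have -> : \sum_i \sum_j (H i j - (A - l) * P i j - l * dl i j) ^+ 2 =
  \sum_i \sum_j H i j ^+ 2 + (A - l) ^+ 2 * (\sum_i \sum_j P i j ^+ 2) +
  l ^+ 2 * (\sum_i \sum_j dl i j * dl i j) - 2 * (A - l) * (\sum_i \sum_j H i j * P i j)
  - 2 * l * (\sum_i \sum_j H i j * dl i j) + 2 * (A - l) * l * (\sum_i \sum_j P i j * dl i j).
  rewrite !mulr_sumr -!sumrN -!big_split /=; apply: eq_bigr => i _.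
  rewrite !mulr_sumr -!sumrN -!big_split /=; apply: eq_bigr => j _.
  move: (H i j) (P i j) (dl i j) => x y w; clear; ring.
rewrite sP sHP sPd sdd (sd H) -etr => h.
rewrite -subr_ge0; apply: le_trans h _; rewrite le_eqVlt; apply/orP; left; apply/eqP.
by rewrite /l; move: (\sum_i \sum_j H i j ^+ 2) n1 => S n1; clear -n1; field.
Qed.

(** * Divergence identities *)

Lemma cvg_sum0 (R : realType) (I : finType) (f : I -> nat -> R) :
  (forall i, f i n @[n --> \oo] --> 0) -> (\sum_i f i n) @[n --> \oo] --> 0.
Proof.
move=> hf; suff : forall s : seq I, (\sum_(i <- s) f i n) @[n --> \oo] --> 0 by exact.
elim=> [|k s ih].
  have -> : (fun n => \sum_(i <- [::]) f i n) = (fun=> 0).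
    by apply/funext => n; rewrite big_nil.
  exact: cvg_cst.
have -> : (fun n => \sum_(i <- k :: s) f i n) = (fun n => f k n + \sum_(i <- s) f i n).
  by apply/funext => n; rewrite big_cons.
by rewrite -[X in _ --> X]addr0; apply: cvgD.
Qed.

Section Fields.
Variables (R : realType) (N : nat) (u eta : 'rV[R]_N -> R) (deta : 'I_N -> 'rV[R]_N -> R).
Hypothesis cu : classC2 u.
Hypothesis u0 : forall x, 0 < u x.
Hypothesis ceta : has_partials eta deta.

Local Notation ud i := (partial_deriv i u).
Local Notation z := (sqgrad u).

(* [hessnn] is A = <H n, n>, [hessn2] is |H n|^2 and [hess2] is |H|^2; the first
   two take the junk value 0 at critical points. *)
Definition hessnn (x : 'rV[R]_N) : R := (\sum_j hessgrad u j x * ud j x) / z x.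
Definition hessn2 (x : 'rV[R]_N) : R := (\sum_j hessgrad u j x ^+ 2) / z x.
Definition hess2 (x : 'rV[R]_N) : R := \sum_i \sum_j partial_deriv j (ud i) x ^+ 2.

Lemma hessnnE x : hessnn x * z x = \sum_j hessgrad u j x * ud j x.
Proof.
rewrite /hessnn; have [z0|zn] := eqVneq (z x) 0; last by rewrite divfK.
by rewrite z0 mulr0 big1 // => j _; rewrite (sqgrad_eq0 j z0) mulr0.
Qed.

Definition field (b c : R) (i : 'I_N) (x : 'rV[R]_N) : R :=
  eta x * (u x `^ b * (z x `^ c * ud i x)).

Definition dfield (b c : R) (i j : 'I_N) (x : 'rV[R]_N) : R :=
  u x `^ b * z x `^ c * (deta j x * ud i x + eta x * (b / u x * (ud j x * ud i x)
     + partial_deriv j (ud i) x + 2 * c * (hessgrad u j x * ud i x / z x))).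

Lemma has_partials_field b c i : 0 <= c ->
  has_partials (field b c i) (dfield b c i).
Proof.
move=> c0; have [cu1 _] := cu.
apply: eq_has_partials (has_partialsM ceta (has_partialsM
  (has_partials_powR b (classC1_partials cu1) u0) (has_partials_gradpow cu i c0))) => [//|j x].
have -> : u x `^ (b - 1) = u x `^ b / u x.
  by rewrite powRB ?powRr1 ?(ltW (u0 x)) // lt0r_neq0 ?implybT.
rewrite /dfield; move: (u x `^ b) (z x `^ c) (u x)^-1 (z x)^-1 => U Z V Y.
by move: (deta j x) (ud i x) (ud j x) (eta x) (partial_deriv j (ud i) x) (hessgrad u j x); clear => *; ring.
Qed.

Lemma div_field b c x : \sum_i dfield b c i i x =
  u x `^ b * z x `^ c * (\sum_i deta i x * ud i x
    + eta x * (b * (z x / u x) + laplacian u x + 2 * c * hessnn x)).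
Proof.
rewrite /dfield -mulr_sumr; congr (_ * _).
rewrite big_split /= -mulr_sumr; congr (_ + _ * _).
rewrite !big_split /= -!mulr_sumr -mulr_suml; congr (_ + _ + _).
have -> : \sum_i ud i x * ud i x = z x by apply: eq_bigr => i _; rewrite expr2.
by rewrite mulrAC mulrA.
Qed.

Lemma cross_field b c x :
  \sum_i \sum_j dfield b c i j x * partial_deriv i (ud j) x =
  u x `^ b * z x `^ c * (\sum_j deta j x * hessgrad u j x
    + eta x * (b * (z x / u x) * hessnn x + hess2 x + 2 * c * hessn2 x)).
Proof.
have E i j : dfield b c i j x * partial_deriv i (ud j) x = u x `^ b * z x `^ c *
  (deta j x * (partial_deriv j (ud i) x * ud i x) + eta x * (b / u x * (ud j x * (partial_deriv j (ud i) x * ud i x))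
     + partial_deriv j (ud i) x ^+ 2 + 2 * c / z x * (hessgrad u j x * (partial_deriv j (ud i) x * ud i x)))).
  rewrite /dfield (partial_derivC j i x cu).
  move: (u x `^ b * z x `^ c) (u x)^-1 (z x)^-1 => U V Y.
  by move: (deta j x) (ud i x) (ud j x) (eta x) (partial_deriv j (ud i) x) (hessgrad u j x); clear => *; ring.
rewrite exchange_big /=.
under eq_bigr => j _ do under eq_bigr => i _ do rewrite E.
have E2 j : \sum_i u x `^ b * z x `^ c *
  (deta j x * (partial_deriv j (ud i) x * ud i x) + eta x * (b / u x * (ud j x * (partial_deriv j (ud i) x * ud i x))
     + partial_deriv j (ud i) x ^+ 2 + 2 * c / z x * (hessgrad u j x * (partial_deriv j (ud i) x * ud i x))))
  = u x `^ b * z x `^ c * (deta j x * hessgrad u j x + eta x * (b / u x * (hessgrad u j x * ud j x)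
     + (\sum_i partial_deriv j (ud i) x ^+ 2) + 2 * c / z x * hessgrad u j x ^+ 2)).
  rewrite -mulr_sumr; congr (_ * _).
  rewrite big_split /= -!mulr_sumr -/(hessgrad u j x) !big_split /= -!mulr_sumr -/(hessgrad u j x).
  by rewrite [ud j x * _]mulrC expr2.
under eq_bigr => j _ do rewrite E2.
rewrite -mulr_sumr; congr (_ * _).
rewrite big_split /= -mulr_sumr; congr (_ + _ * _).
rewrite 2!big_split /=.
rewrite -[\sum_i b / u x * _]mulr_sumr -[\sum_i 2 * c / z x * _]mulr_sumr.
rewrite [X in _ + X + _ = _]exchange_big /= -/(hess2 x) -hessnnE /hessn2.
move: (\sum_j hessgrad u j x ^+ 2) (hess2 x) (hessnn x) (z x)^-1 (u x)^-1 (z x).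
by move=> S H A Y U Z; clear; ring.
Qed.

Lemma field_eq0 b c i x : eta x = 0 -> field b c i x = 0.
Proof. by rewrite /field => ->; rewrite mul0r. Qed.

Lemma cvg_div_field L b c : (0 < L)%N -> 0 <= c ->
  (forall x, L%:R - 1 < `|x| -> eta x = 0) ->
  gridsum L n (fun x => u x `^ b * z x `^ c * (\sum_i deta i x * ud i x
    + eta x * (b * (z x / u x) + laplacian u x + 2 * c * hessnn x))) @[n --> \oo] --> 0.
Proof.
move=> L0 c0 eta0.
have -> : (fun n => gridsum L n (fun x => u x `^ b * z x `^ c * (\sum_i deta i x * ud i x
    + eta x * (b * (z x / u x) + laplacian u x + 2 * c * hessnn x)))) =
  (fun n => \sum_i gridsum L n (partial_deriv i (field b c i))).
  apply/funext => n; rewrite -gridsum_sum; apply: eq_gridsum => x _.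
  rewrite -div_field; apply: eq_bigr => i _.
  by have /has_partialsP [_ ->] := has_partials_field b i c0.
apply: cvg_sum0 => i; apply: gridsum_ibp1 => //.
  by have /has_partialsP [] := has_partials_field b i c0.
by move=> x xL; apply: field_eq0; exact: eta0.
Qed.

Lemma cvg_cross_field L b c : (0 < L)%N -> 0 <= c ->
  (forall x, L%:R - 1 < `|x| -> eta x = 0) ->
  gridsum L n (fun x =>
    u x `^ b * z x `^ c * (\sum_i deta i x * ud i x
      + eta x * (b * (z x / u x) + laplacian u x + 2 * c * hessnn x)) * laplacian u x
  - u x `^ b * z x `^ c * (\sum_j deta j x * hessgrad u j x
    + eta x * (b * (z x / u x) * hessnn x + hess2 x + 2 * c * hessn2 x)))
   @[n --> \oo] --> 0.
Proof.
move=> L0 c0 eta0; have [_ cdu] := cu.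
pose T i j x := partial_deriv i (field b c i) x * partial_deriv j (ud j) x
  - partial_deriv j (field b c i) x * partial_deriv i (ud j) x.
have E n : gridsum L n (fun x =>
    u x `^ b * z x `^ c * (\sum_i deta i x * ud i x
      + eta x * (b * (z x / u x) + laplacian u x + 2 * c * hessnn x)) * laplacian u x
  - u x `^ b * z x `^ c * (\sum_j deta j x * hessgrad u j x
    + eta x * (b * (z x / u x) * hessnn x + hess2 x + 2 * c * hessn2 x)))
  = \sum_i \sum_j gridsum L n (T i j).
  under eq_bigr => i _ do rewrite -gridsum_sum.
  rewrite -gridsum_sum; apply: eq_gridsum => x _.
  rewrite -div_field -cross_field mulr_suml -sumrB; apply: eq_bigr => i _.
  have /has_partialsP [_ e] := has_partials_field b i c0.
  rewrite /laplacian [X in X - _ = _]mulr_sumr -sumrB; apply: eq_bigr => j _.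
  by rewrite /T (e i x) (e j x).
under eq_cvg => n do rewrite E.
apply: cvg_sum0 => i; apply: cvg_sum0 => j; apply: gridsum_ibp2 => //.
- by have /has_partialsP [] := has_partials_field b i c0.
- by move=> x xL; apply: field_eq0; exact: eta0.
Qed.

End Fields.

(** * The subcritical supersolution range *)

Lemma solution_laplacian (R : realType) (N : nat) (p q : R) (u : 'rV[R]_N -> R) x :
  positive_solution p q u -> laplacian u x = - (u x `^ p * sqgrad u x `^ (q / 2)).
Proof.
move=> [_ _ /(_ x) h]; rewrite -[LHS]opprK h; congr (- (_ * _)).
rewrite /euclidean_norm.
have -> : \sum_(i < N) gradient u x 0 i ^+ 2 = sqgrad u x.
  by apply: eq_bigr => i _; rewrite mxE.
by rewrite -powR12_sqrt ?sqgrad_ge0 // -powRrM mulrC.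
Qed.

Lemma sqgrad0_cst (R : realType) (N : nat) (u : 'rV[R]_N -> R) : classC1 u ->
  (forall x, sqgrad u x = 0) -> exists c, forall x, u x = c.
Proof.
move=> [_ cu] z0; exists (u 0) => x.
have step (i : 'I_N) (s : R) y : u (y + s *: delta_mx 0 i) = u y.
  wlog s0 : s y / 0 < s.
    move=> H; have [s0|] := ltP 0 s; first exact: H.
    rewrite le_eqVlt => /predU1P [->|s0]; first by rewrite scale0r addr0.
    have := H (- s) (y + s *: delta_mx 0 i); rewrite oppr_gt0 => /(_ s0) <-.
    by rewrite scaleNr addrK.
  have [t _ /eqP] := MVT_line y (cu i).1 s0.
  have -> : 'D_(delta_mx 0 i) u (y + t *: delta_mx 0 i) = 0 by exact: (sqgrad_eq0 i (z0 _)).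
  by rewrite mulr0 subr_eq0 => /eqP.
have : forall s : seq 'I_N, u (\sum_(i <- s) x 0 i *: delta_mx 0 i) = u 0.
  by elim=> [|i s ih]; rewrite ?big_nil // big_cons addrC step.
by move=> h; rewrite -[RHS](h (index_enum 'I_N)) -row_sum_delta.
Qed.

Lemma sum_sqr_entry_le (R : realType) (N : nat) (H : 'I_N -> 'I_N -> R) i j :
  H i j ^+ 2 <= \sum_a \sum_b H a b ^+ 2.
Proof.
apply: (@le_trans _ _ (\sum_b H i b ^+ 2)).
  by rewrite (bigD1 j) //= lerDl sumr_ge0 // => b _; exact: sqr_ge0.
rewrite [leRHS](bigD1 i) //= lerDl sumr_ge0 // => a _.
by apply: sumr_ge0 => b _; exact: sqr_ge0.
Qed.

Section Bounds.
Variables (R : realType) (N : nat) (u : 'rV[R]_N -> R).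
Hypothesis cu : classC2 u.
Hypothesis u0 : forall x, 0 < u x.

Lemma continuous_uz (b c : R) : 0 <= c -> continuous (fun x => u x `^ b * sqgrad u x `^ c).
Proof.
move=> c0; have [cu1 _] := cu; apply: continuous_mul.
  by have [] := has_partials_powR b (classC1_partials cu1) u0.
have [->|cn] := eqVneq c 0.
  have -> : (fun x => sqgrad u x `^ 0) = (fun=> 1) by apply/funext => x; rewrite powRr0.
  exact: cst_continuous.
apply: continuous_powR_ge0 => [|x|]; [|exact: sqgrad_ge0|by rewrite lt0r cn].
by have [] := has_partials_sqgrad cu.
Qed.

Lemma grad_dot_le (v : 'I_N -> R) (D : R) x : (forall i, `|v i| <= D) ->
  `|\sum_i v i * partial_deriv i u x| <= N%:R * D * Num.sqrt (sqgrad u x).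
Proof.
move=> vD; apply: le_trans (ler_norm_sum _ _ _) _.
have -> : N%:R * D * Num.sqrt (sqgrad u x) = \sum_(i < N) D * Num.sqrt (sqgrad u x).
  by rewrite sumr_const card_ord -[RHS]mulr_natl [RHS]mulrA.
apply: ler_sum => i _; rewrite normrM; apply: ler_pM => //.
exact: partial_deriv_le_sqgrad.
Qed.

Lemma hess_dot_le (v : 'I_N -> R) (D : R) x : (forall i, `|v i| <= D) ->
  `|\sum_i v i * hessgrad u i x| <=
    N%:R * D * (N%:R * Num.sqrt (hess2 u x) * Num.sqrt (sqgrad u x)).
Proof.
move=> vD; apply: le_trans (ler_norm_sum _ _ _) _.
set E := N%:R * Num.sqrt (hess2 u x) * _.
have -> : N%:R * D * E = \sum_(i < N) D * E.
  by rewrite sumr_const card_ord -[RHS]mulr_natl [RHS]mulrA.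
apply: ler_sum => j _; rewrite normrM; apply: ler_pM => //.
apply: grad_dot_le => i; rewrite -sqrtr_sqr; apply: ler_wsqrtr.
exact: (sum_sqr_entry_le (fun a b => partial_deriv b (partial_deriv a u) x)).
Qed.

Lemma hessnn_le x : hessnn u x ^+ 2 <= hessn2 u x.
Proof.
rewrite /hessn2; have [z0|zn] := eqVneq (sqgrad u x) 0.
  by rewrite /hessnn z0 invr0 !mulr0 expr0n.
have zp : 0 < sqgrad u x by rewrite lt0r zn sqgrad_ge0.
rewrite ler_pdivlMr //; set A := hessnn u x.
have : 0 <= \sum_j (hessgrad u j x - A * partial_deriv j u x) ^+ 2.
  by apply: sumr_ge0 => j _; exact: sqr_ge0.
have -> : \sum_j (hessgrad u j x - A * partial_deriv j u x) ^+ 2 =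
  \sum_j hessgrad u j x ^+ 2 - 2 * A * (\sum_j hessgrad u j x * partial_deriv j u x)
   + A ^+ 2 * sqgrad u x.
  rewrite /sqgrad [2 * A * _]mulr_sumr [A ^+ 2 * _]mulr_sumr -sumrB -big_split /=.
  apply: eq_bigr => j _; move: (hessgrad u j x) (partial_deriv j u x) A; clear => *; ring.
rewrite -hessnnE -/A; move: (\sum_j _) (sqgrad u x) => S Z.
by clear => h; rewrite -subr_ge0; move: h; congr (0 <= _); ring.
Qed.

End Bounds.

Lemma exists_cutoff_exponent (R : realType) (si : R) : 0 < si ->
  exists2 k, (0 < k)%N & 1 <= k.+1%:R * si.
Proof.
move=> si0; have h : 0 <= si^-1 by rewrite invr_ge0 ltW.
exists (Num.bound si^-1).+1 => //; rewrite -ler_pdivrMr // mul1r.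
by apply: ltW; apply: lt_le_trans (archi_boundP h) _; rewrite ler_nat; exact/leqW/leqnSn.
Qed.

Lemma theta_support (R : realType) (N k rho : nat) (x : 'rV[R]_N) : (0 < rho)%N ->
  (rho + 2)%:R - 1 < `|x| -> theta rho%:R x ^+ (2 * k.+1) = 0.
Proof.
move=> rho0 xL; rewrite theta_eq0 ?expr0n ?muln_eq0 ?ltr0n //.
by apply: le_lt_trans xL; rewrite natrD; clear; lra.
Qed.

Lemma supersolution_sqgrad0 (R : realType) (N : nat) (p q : R) (u : 'rV[R]_N -> R) :
  (2 <= N)%N -> 0 <= p -> 0 <= q -> q < 2 ->
  (N%:R - 2) * p + (N%:R - 1) * q < N%:R ->
  positive_solution p q u -> forall x, sqgrad u x = 0.
Proof.
move=> N2 p0 q0 q2 sub hu.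
have [s [al [be [si [[s0 al0 be0 si0] [s1 Nsi e1 e2]]]]]] := easy_exponents N2 p0 q0 q2 sub.
have [cu u0 _] := hu.
have [k k0 ksi] := exists_cutoff_exponent si0.
pose m0 := Num.min s 1.
have m00 : 0 < m0 by rewrite lt_min s0 /=.
have m0s : m0 <= s by rewrite ge_min lexx.
have m01 : m0 <= 1 by rewrite ge_min lexx orbT.
pose c1 := N%:R * (4 * k.+1%:R) : R.
have c10 : 0 < c1 by rewrite mulr_gt0 // ltr0n; apply: leq_trans N2.
have eps0 : 0 < m0 / 2 / c1 by rewrite !divr_gt0.
have lK : (2 * k.+1)%:R * (1 - si) <= (2 * k).+1%:R.
  have ka : (2 * k.+1)%:R = 2 * (k%:R + 1) :> R by rewrite natrM natr1.
  have kb : (2 * k).+1%:R = 2 * k%:R + 1 :> R by rewrite -natrM natr1.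
  have kc : k.+1%:R = k%:R + 1 :> R by rewrite natr1.
  move: ksi; rewrite ka kb kc; move: (k%:R : R) => n; clear => *; lra.
have half0 : 2^-1 != 0 :> R by rewrite invr_neq0.
have e1' : 2^-1 = al * 1 + be * (q / 2) by rewrite mulr1.
have [C C0 hC] := young_weight al0 be0 si0 s1 eps0 e2 e1' half0 (ltn0Sn _) lK.
pose z := sqgrad u.
pose g x := u x `^ (- s - 1) * z x `^ 1 + u x `^ (p - s) * z x `^ (q / 2).
have g0 x : 0 <= g x by rewrite addr_ge0 // mulr_ge0 ?powR_ge0.
have cg : continuous g.
  by apply: continuous_add; apply: continuous_uz => //; rewrite divr_ge0.
pose eta (rho : nat) (x : 'rV[R]_N) : R := theta rho%:R x ^+ (2 * k.+1).
pose deta (rho : nat) (j : 'I_N) (x : 'rV[R]_N) : R :=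
  k.+1%:R * theta rho%:R x ^+ (2 * k).+1 * (- 4 * rho%:R ^- 2 * x 0 j).
pose S rho x := u x `^ (- s) * z x `^ 0 * (\sum_i deta rho i x * partial_deriv i u x
    + eta rho x * (- s * (z x / u x) + laplacian u x + 2 * 0 * hessnn u x)).
have scheme := @liouville_scheme R N (2 * k.+1) g (fun rho x => - (2 / m0) * S rho x)
   (2 / m0 * (c1 * C)) (si^-1) cg g0.
have gz : forall x, g x = 0.
  apply: scheme.
  - by rewrite -[si^-1]mul1r ltr_pdivlMr.
  - by rewrite !mulr_ge0 ?invr_ge0 ?(ltW m00) ?(ltW c10).
  - move=> rho rho0.
    have ceta : has_partials (eta rho) (deta rho) by exact: has_partials_theta.
    have -> : (fun n => gridsum (rho + 2) n (fun x => - (2 / m0) * S rho x))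
       = (fun n => - (2 / m0) * gridsum (rho + 2) n (S rho)).
      by apply/funext => n; rewrite gridsumZ.
    rewrite -[X in _ --> X](mulr0 (- (2 / m0))); apply: cvgM; first exact: cvg_cst.
    apply: (cvg_div_field cu u0 ceta) => //; first by rewrite addn_gt0 rho0.
    by move=> x; exact: theta_support.
  move=> rho rho0 x.
  have r0 : 0 < rho%:R :> R by rewrite ltr0n.
  have rt0 : 0 <= rho%:R `^ (- si^-1) :> R by exact: powR_ge0.
  have rE : (rho%:R `^ (- si^-1)) `^ si = rho%:R^-1 :> R.
    by rewrite -powRrM mulNr mulVf ?lt0r_neq0 // powRN powRr1 // ltW.
  have := hC (u x) (z x) (theta rho%:R x) _ (u0 x) (sqgrad_ge0 u x) (theta_ge0 _ _) (theta_le1 _ _) rt0.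
  rewrite rE -/(g x) -/(eta rho x) => Y.
  have B : `|\sum_i deta rho i x * partial_deriv i u x| <=
      c1 * (z x `^ 2^-1 * theta rho%:R x ^+ (2 * k).+1 * rho%:R^-1).
    apply: le_trans (grad_dot_le u x (fun i => partial_theta_le k i x r0)) _.
    rewrite -powR12_sqrt ?sqgrad_ge0 // /c1 le_eqVlt; apply/orP; left; apply/eqP.
    rewrite -/(z x); move: (z x `^ 2^-1) (theta _ x ^+ _) (rho%:R^-1); clear => *; ring.
  have US : u x `^ (- s) * (s * (z x / u x) + u x `^ p * z x `^ (q / 2)) =
      s * (u x `^ (- s - 1) * z x `^ 1) + u x `^ (p - s) * z x `^ (q / 2).
    have un : u x != 0 by rewrite lt0r_neq0.
    have E1 : u x `^ (- s - 1) = u x `^ (- s) / u x.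
      by rewrite powRB ?powRr1 ?(ltW (u0 x)) // un implybT.
    have E2 : u x `^ (p - s) = u x `^ p * u x `^ (- s) by rewrite powRD // un implybT.
    rewrite powRr1 ?sqgrad_ge0 // E1 E2.
    by move: (u x `^ (- s)) (u x `^ p) (z x `^ (q / 2)) (z x) (u x)^-1; clear => *; ring.
  have lapE : S rho x = u x `^ (- s) * (\sum_i deta rho i x * partial_deriv i u x)
      - eta rho x * (s * (u x `^ (- s - 1) * z x `^ 1) + u x `^ (p - s) * z x `^ (q / 2)).
    rewrite -US /S (solution_laplacian x hu) powRr0 -/(z x).
    by move: (u x `^ (- s)) (\sum_i _) (eta rho x) (z x / u x) (u x `^ p * _) (hessnn u x); clear => *; ring.
  have G : m0 * g x <= s * (u x `^ (- s - 1) * z x `^ 1) + u x `^ (p - s) * z x `^ (q / 2).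
    rewrite /g mulrDr; apply: lerD; first by rewrite ler_wpM2r // mulr_ge0 ?powR_ge0.
    by rewrite -[leRHS]mul1r ler_wpM2r // mulr_ge0 ?powR_ge0.
  have U0 : 0 <= u x `^ (- s) by exact: powR_ge0.
  have Bd : `|u x `^ (- s) * (\sum_i deta rho i x * partial_deriv i u x)| <=
      m0 / 2 * (eta rho x * g x) + c1 * C * rho%:R `^ (- si^-1).
    rewrite normrM (ger0_norm U0); apply: le_trans (ler_wpM2l U0 B) _.
    have Yc := ler_wpM2l (ltW c10) Y.
    have -> : u x `^ (- s) * (c1 * (z x `^ 2^-1 * theta rho%:R x ^+ (2 * k).+1 / rho%:R))
      = c1 * (u x `^ (- s) * z x `^ 2^-1 * theta rho%:R x ^+ (2 * k).+1 / rho%:R).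
      by move: (u x `^ (- s)) (z x `^ 2^-1) (theta _ x ^+ _) (rho%:R^-1); clear => *; ring.
    have cc : c1 * (m0 / 2 / c1) = m0 / 2 by rewrite mulrC divfK // lt0r_neq0.
    by apply: le_trans Yc _; rewrite mulrDr [c1 * (m0 / 2 / c1 * _)]mulrA cc [c1 * (C * _)]mulrA.
  have eta0 : 0 <= eta rho x by rewrite exprn_ge0 // theta_ge0.
  have eG := ler_wpM2l eta0 G.
  have m2 : 0 < 2 / m0 by rewrite divr_gt0.
  rewrite -(ler_pM2l (_ : 0 < m0 / 2)); last by rewrite divr_gt0.
  have -> : m0 / 2 * (- (2 / m0) * S rho x + 2 / m0 * (c1 * C) * rho%:R `^ (- si^-1))
     = - S rho x + c1 * C * rho%:R `^ (- si^-1).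
    have mn := lt0r_neq0 m00.
    by move: (S rho x) (rho%:R `^ (- si^-1)) => A T; clear -mn; field.
  rewrite lapE; move: Bd eG; rewrite ler_norml => /andP [_].
  move: (u x `^ (- s) * _) (eta rho x) (g x) (s * _ + _) (c1 * C * _) => A E G' Q T.
  by clear => *; lra.
move=> x; have /eqP := gz x.
rewrite /g paddr_eq0 ?mulr_ge0 ?powR_ge0 // mulf_eq0 powRr1 ?sqgrad_ge0 // => /andP [+ _].
by rewrite (negPf (lt0r_neq0 (powR_gt0 _ (u0 x)))) /= => /eqP.
Qed.

(** * The remaining range *)

Lemma powRD_ge0 (R : realType) (x r s : R) : 0 <= r -> 0 <= s ->
  x `^ (r + s) = x `^ r * x `^ s.
Proof.
move=> r0 s0; have [|rs] := eqVneq (r + s) 0; last by rewrite powRD // (negPf rs).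
move=> /eqP; rewrite paddr_eq0 // => /andP [/eqP -> /eqP ->].
by rewrite addr0 powRr0 mulr1.
Qed.

Lemma young_square (R : realFieldType) (d c t0 t1 y : R) : 0 < d ->
  c * (t0 * t1) * y <= d / 2 * (t1 ^+ 2 * y ^+ 2) + c ^+ 2 / (2 * d) * t0 ^+ 2.
Proof.
move=> d0; have dn := lt0r_neq0 d0; rewrite -subr_ge0.
have -> : d / 2 * (t1 ^+ 2 * y ^+ 2) + c ^+ 2 / (2 * d) * t0 ^+ 2 - c * (t0 * t1) * y
  = (d * t1 * y - c * t0) ^+ 2 / (2 * d) by field.
by rewrite divr_ge0 ?sqr_ge0 // mulr_ge0 // ltW.
Qed.

Lemma boundary_absorb (R : realFieldType) (d n k s f w h D1 D2 t0 t1 : R) :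
  0 < d -> 0 <= n -> 0 <= f -> 0 <= w -> 0 <= h -> 0 <= t0 -> 0 <= t1 ->
  `|D1| <= t0 * t1 -> `|D2| <= n * h * (t0 * t1) ->
  - (d / 2 * (t1 ^+ 2 * (h ^+ 2 + f ^+ 2 + w ^+ 2))
     + 3 * ((1 + `|k| + n + `|s|) ^+ 2 / (2 * d)) * t0 ^+ 2)
   <= f * D1 + D2 - k * (f * D1) - s * (w * D1).
Proof.
move=> d0 n0 f0 w0 h0 t00 t10 hD1 hD2.
set c := 1 + `|k| + n + `|s|.
have y1 := young_square c t0 t1 f d0.
have y2 := young_square c t0 t1 h d0.
have y3 := young_square c t0 t1 w d0.
have T0 : 0 <= t0 * t1 by rewrite mulr_ge0.
have nk := normr_ge0 k; have ns := normr_ge0 s.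
apply: (@le_trans _ _ (- (c * (t0 * t1) * f + c * (t0 * t1) * h + c * (t0 * t1) * w))).
  rewrite lerN2; move: y1 y2 y3; move: (c ^+ 2 / (2 * d)) (c * (t0 * t1)) => a b.
  by clear => *; lra.
suff : `|f * D1 + D2 - k * (f * D1) - s * (w * D1)| <=
    c * (t0 * t1) * f + c * (t0 * t1) * h + c * (t0 * t1) * w.
  by rewrite ler_norml => /andP [].
have fD : `|f * D1| <= t0 * t1 * f by rewrite normrM (ger0_norm f0) mulrC ler_wpM2r.
have wD : `|w * D1| <= t0 * t1 * w by rewrite normrM (ger0_norm w0) mulrC ler_wpM2r.
have kD : `|k * (f * D1)| <= `|k| * (t0 * t1 * f) by rewrite normrM ler_wpM2l.
have sD : `|s * (w * D1)| <= `|s| * (t0 * t1 * w) by rewrite normrM ler_wpM2l.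
apply: le_trans (ler_normB _ _) _.
apply: le_trans (lerD (ler_normB _ _) (lexx _)) _.
apply: le_trans (lerD (lerD (ler_normD _ _) (lexx _)) (lexx _)) _.
apply: le_trans (lerD (lerD (lerD fD hD2) kD) sD) _.
have g1 : 0 <= (n + `|s|) * (t0 * t1 * f) by rewrite !mulr_ge0 ?addr_ge0.
have g2 : 0 <= (1 + `|k| + `|s|) * (t0 * t1 * h) by rewrite !mulr_ge0 ?addr_ge0.
have g3 : 0 <= (1 + `|k| + n) * (t0 * t1 * w) by rewrite !mulr_ge0 ?addr_ge0.
rewrite /c; move: g1 g2 g3; move: (t0 * t1) (`|k|) (`|s|) => T a b.
by clear => *; lra.
Qed.

Lemma combine_estimates (R : realFieldType) (d E W H2 f w QW RR c Z r : R) :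
  E * (d * (W * (H2 + f ^+ 2 + w ^+ 2))) <= E * QW ->
  W * - (d / 2 * (E * (H2 + f ^+ 2 + w ^+ 2)) + c * Z) <= W * RR ->
  W * (c * Z) <= d / 4 * (E * (W * (w ^+ 2 + f ^+ 2))) + c * r ->
  0 <= d / 2 * (E * (W * H2)) ->
  d / 4 * (E * (W * (w ^+ 2 + f ^+ 2))) <= E * QW + W * RR + c * r.
Proof. by move=> *; lra. Qed.

Definition source (R : realType) (N : nat) (p q : R) (u : 'rV[R]_N -> R)
    (x : 'rV[R]_N) : R := u x `^ p * sqgrad u x `^ (q / 2).

Lemma hess2_ge (R : realType) (N : nat) (p q : R) (u : 'rV[R]_N -> R) (x : 'rV[R]_N) :
  (2 <= N)%N -> positive_solution p q u -> sqgrad u x != 0 ->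
  hessnn u x ^+ 2 + (source p q u x + hessnn u x) ^+ 2 / (N%:R - 1) <= hess2 u x.
Proof.
move=> N2 hu zn.
have := @hessian_trace_ge _ _ (fun i j => partial_deriv j (partial_deriv i u) x)
  (fun i => partial_deriv i u x) (sqgrad u x) (hessnn u x) (laplacian u x) N2 erefl zn erefl.
rewrite (solution_laplacian x hu) -/(source p q u x) -opprD sqrrN; apply.
rewrite hessnnE /hessgrad exchange_big /=; apply: eq_bigr => j _.
by rewrite mulr_suml; apply: eq_bigr => i _; rewrite mulrA.
Qed.

Lemma sum_delta2 (R : nzRingType) (N : nat) (G : 'I_N -> 'I_N -> R) (k : 'I_N) :
  \sum_i \sum_j G i j * ((i == k)%:R * (j == k)%:R) = G k k.
Proof.
rewrite (bigD1 k) //= (bigD1 k) //= eqxx !mulr1 big1 => [|j /negPf ->].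
  rewrite addr0 big1 ?addr0 // => i /negPf ->.
  by apply: big1 => j _; rewrite mul0r mulr0.
by rewrite mulr0 mulr0.
Qed.

Lemma weighted_coercive (R : realType) (N : nat) (p q e a k s : R) (u : 'rV[R]_N -> R) :
  (2 <= N)%N -> positive_solution p q u -> good_params (N%:R - 1) p q e a k s ->
  exists2 d, 0 < d & forall x,
  let w := sqgrad u x / u x in let f := source p q u x in let A := hessnn u x in
  let W := u x `^ a * sqgrad u x `^ e in
  d * (W * (hess2 u x + f ^+ 2 + w ^+ 2)) <=
  W * (hess2 u x - f ^+ 2 + a * w * (A + f) + 2 * e * (hessn2 u x + f * A)
   - k * ((a + p) * f * w + (2 * e + q) * f * A - f ^+ 2)
   - s * ((a - 1) * w ^+ 2 + 2 * (e + 1) * A * w - f * w)).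
Proof.
move=> N2 hu hpar; have [_ u0 _] := hu.
have m1 : 1 <= N%:R - 1 :> R.
  by rewrite lerBrDr (_ : 1 + 1 = 2%:R) ?ler_nat.
have [d d0 hd] := good_params_coercive m1 hpar.
exists d; first exact: d0.
move=> x /=; set w := sqgrad u x / u x; set f := source p q u x.
set A := hessnn u x; set W := u x `^ a * sqgrad u x `^ e.
have W0 : 0 <= W by rewrite mulr_ge0 ?powR_ge0.
have f0 : 0 <= f by rewrite mulr_ge0 ?powR_ge0.
have w0 : 0 <= w by rewrite divr_ge0 ?sqgrad_ge0 // ltW.
have [z0|zn] := eqVneq (sqgrad u x) 0; last first.
  rewrite mulrCA; apply: ler_wpM2l => //; apply: hd => //; first exact: hess2_ge.
  exact: hessnn_le.
have [[e0 _ _ _] _] := hpar.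
have [e00|en] := eqVneq e 0; last first.
  by rewrite /W z0 powR0 // mulr0 !mul0r mulr0.
rewrite mulrCA; apply: ler_wpM2l => //.
have A0 : A = 0 by rewrite /A /hessnn z0 invr0 mulr0.
have w00 : w = 0 by rewrite /w z0 mul0r.
have [i0 _] : exists i0 : 'I_N, True by exists (Ordinal (ltnW N2)).
pose A' := partial_deriv i0 (partial_deriv i0 u) x.
have xi1 : \sum_i ((i == i0)%:R : R) ^+ 2 = 1.
  rewrite (bigD1 i0) //= eqxx big1 ?addr0 ?expr1n // => i /negPf ->.
  by rewrite expr0n.
have tr := @hessian_trace_ge _ _ (fun i j => partial_deriv j (partial_deriv i u) x)
  (fun i => (i == i0)%:R) 1 A' (laplacian u x) N2 (esym xi1) (oner_neq0 _) erefl.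
have hA' : A' * 1 = \sum_i \sum_j partial_deriv j (partial_deriv i u) x * ((i == i0)%:R * (j == i0)%:R).
  by rewrite (sum_delta2 (fun i j => partial_deriv j (partial_deriv i u) x)) mulr1.
have {tr} := tr hA'; rewrite (solution_laplacian x hu) -/(source p q u x) -/f -opprD sqrrN => tr.
have := hd A' f 0 (hess2 u x) (A' ^+ 2) f0 (lexx _) tr (lexx _).
have qf : q * f = 0.
  have [->|qn] := eqVneq q 0; first by rewrite mul0r.
  by rewrite /f /source z0 powR0 ?mulr0 // mulf_neq0 // invr_neq0.
rewrite e00 w00 A0; move: qf; clear; clearbody f A'.
move: (hess2 u x) (hessn2 u x) => H2 B2 qf.
have -> : (2 * 0 + q) * f * A' = 0 by rewrite mulr0 add0r qf mul0r.
by rewrite !(mulr0, mul0r, expr0n, addr0, subr0) /=.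
Qed.


Lemma good_params_sqgrad0 (R : realType) (N : nat) (p q e a k s : R) (u : 'rV[R]_N -> R) :
  (2 <= N)%N -> 0 <= p -> 0 <= q -> q < 2 -> 1 < p + q ->
  good_params (N%:R - 1) p q e a k s ->
  positive_solution p q u -> forall x, sqgrad u x = 0.
Proof.
move=> N2 p0 q0 q2 pq hpar hu.
have [[e0 a0 ha hB] _] := hpar.
have hB' : (N%:R - 4 - 2 * e) * (p + q - 1) < (2 - q) * (a + 2 * e + 2).
  by have -> : N%:R - 4 - 2 * e = N%:R - 1 - 3 - 2 * e by clear; ring.
have [al [be [si [[al0 be0 si0] [s1 Nsi e1 e2]]]]] := main_exponents p0 q0 q2 pq e0 a0 ha hB'.
have [d d0 hd] := weighted_coercive N2 hu hpar.
have [cu u0 _] := hu.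
have [K K0 Ksi] := exists_cutoff_exponent si0.
pose C0 := 1 + `|k| + N%:R + `|s|.
have C00 : 0 < C0 by rewrite /C0 -!addrA ltr_wpDr // !addr_ge0.
pose c1 := N%:R * (4 * K.+1%:R) : R.
pose c2 := 3 * (C0 ^+ 2 / (2 * d)) * c1 ^+ 2.
have c10 : 0 < c1 by rewrite mulr_gt0 // ltr0n; apply: leq_trans N2.
have c20 : 0 < c2.
  by rewrite mulr_gt0 ?exprn_gt0 // mulr_gt0 // divr_gt0 ?exprn_gt0 // mulr_gt0.
have eps0 : 0 < d / 4 / c2 by rewrite !divr_gt0.
have lK : (2 * K.+1)%:R * (1 - si) <= (2 * K)%:R.
  have ka : (2 * K.+1)%:R = 2 * (K%:R + 1) :> R by rewrite natrM natr1.
  have kc : K.+1%:R = K%:R + 1 :> R by rewrite natr1.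
  move: Ksi; rewrite ka natrM kc; move: (K%:R : R) => n; clear => *; lra.
have en0 : e + 1 != 0 by rewrite lt0r_neq0 // ltr_wpDl.
have l0 : (0 < 2 * K)%N by rewrite muln_gt0.
have [C Cge0 hC] := young_weight al0 be0 si0 s1 eps0 e2 e1 en0 l0 lK.
pose z := sqgrad u.
pose g x := u x `^ (a - 2) * z x `^ (e + 2) + u x `^ (a + 2 * p) * z x `^ (e + q).
have g0 x : 0 <= g x by rewrite addr_ge0 // mulr_ge0 ?powR_ge0.
have cg : continuous g.
  by apply: continuous_add; apply: continuous_uz => //; rewrite addr_ge0.
pose eta (rho : nat) (x : 'rV[R]_N) : R := theta rho%:R x ^+ (2 * K.+1).
pose deta (rho : nat) (j : 'I_N) (x : 'rV[R]_N) : R :=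
  K.+1%:R * theta rho%:R x ^+ (2 * K).+1 * (- 4 * rho%:R ^- 2 * x 0 j).
pose S b c rho x := u x `^ b * z x `^ c * (\sum_i deta rho i x * partial_deriv i u x
    + eta rho x * (b * (z x / u x) + laplacian u x + 2 * c * hessnn u x)).
pose S3 rho x := S a e rho x * laplacian u x
  - u x `^ a * z x `^ e * (\sum_j deta rho j x * hessgrad u j x
    + eta rho x * (a * (z x / u x) * hessnn u x + hess2 u x + 2 * e * hessn2 u x)).
pose T rho x := S3 rho x + (k * S (a + p) (e + q / 2) rho x + s * S (a - 1) (e + 1) rho x).
have scheme := @liouville_scheme R N (2 * K.+1) g (fun rho x => - (4 / d) * T rho x)
   (4 / d * (c2 * C)) (2 / si) cg g0.
have gz : forall x, g x = 0.
  apply: scheme.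
  - by rewrite ltr_pdivlMr.
  - by rewrite mulr_ge0 ?divr_ge0 ?(ltW d0) // mulr_ge0 // ltW.
  - move=> rho rho0.
    have ceta : has_partials (eta rho) (deta rho) by exact: has_partials_theta.
    have supp x : (rho + 2)%:R - 1 < `|x| -> eta rho x = 0 by exact: theta_support.
    have L0 : (0 < rho + 2)%N by rewrite addn_gt0 rho0.
    have -> : (fun n => gridsum (rho + 2) n (fun x => - (4 / d) * T rho x))
       = (fun n => - (4 / d) * (gridsum (rho + 2) n (S3 rho) +
           (k * gridsum (rho + 2) n (S (a + p) (e + q / 2) rho)
             + s * gridsum (rho + 2) n (S (a - 1) (e + 1) rho)))).
      by apply/funext => n; rewrite gridsumZ !gridsumD !gridsumZ.
    have eq0 : 0 <= e + q / 2 by rewrite addr_ge0 // divr_ge0.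
    have h1 := @cvg_div_field _ _ _ _ _ cu u0 ceta (rho + 2)%N (a + p) _ L0 eq0 supp.
    have h2 := @cvg_div_field _ _ _ _ _ cu u0 ceta (rho + 2)%N (a - 1) _ L0 (addr_ge0 e0 ler01) supp.
    have h3 := @cvg_cross_field _ _ _ _ _ cu u0 ceta (rho + 2)%N a _ L0 e0 supp.
    have E : 0 = - (4 / d) * (0 + (k * 0 + s * 0)) by rewrite !mulr0 !addr0 mulr0.
    rewrite [X in _ --> X]E; apply: cvgM; first exact: cvg_cst.
    apply: cvgD; first exact: h3.
    by apply: cvgD; (apply: cvgM; first exact: cvg_cst).
  move=> rho rho0 x.
  have r0 : 0 < rho%:R :> R by rewrite ltr0n.
  have rt0 : 0 <= rho%:R `^ (- (2 / si)) :> R by exact: powR_ge0.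
  have rE : (rho%:R `^ (- (2 / si))) `^ si = rho%:R ^- 2 :> R.
    by rewrite -powRrM mulNr divfK ?lt0r_neq0 // powRN powR_mulrn // ltW.
  have := hC (u x) (z x) (theta rho%:R x) _ (u0 x) (sqgrad_ge0 u x) (theta_ge0 _ _) (theta_le1 _ _) rt0.
  rewrite rE -/(g x) -/(eta rho x) => Y.
  have Q := hd x; rewrite /= in Q.
  have th0 : 0 <= theta rho%:R x by exact: theta_ge0.
  have B1 := grad_dot_le u x (fun i => partial_theta_le K i x r0).
  have B2 := hess_dot_le u x (fun i => partial_theta_le K i x r0).
  pose w := z x / u x; pose f := u x `^ p * z x `^ (q / 2).
  pose W := u x `^ a * z x `^ e.
  have un : u x != 0 by rewrite lt0r_neq0.
  have z0 : 0 <= z x by exact: sqgrad_ge0.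
  have f0 : 0 <= f by rewrite mulr_ge0 ?powR_ge0.
  have w0 : 0 <= w by rewrite divr_ge0 // ltW.
  have W0 : 0 <= W by rewrite mulr_ge0 ?powR_ge0.
  have q20 : 0 <= q / 2 by rewrite divr_ge0.
  have ze1 : z x `^ (e + 1) = z x `^ e * z x by rewrite powRD_ge0 // powRr1.
  have P1 : u x `^ (a + p) * z x `^ (e + q / 2) = W * f.
    by rewrite powRD ?un ?implybT // powRD_ge0 // /W /f mulrACA.
  have P2 : u x `^ (a - 1) * z x `^ (e + 1) = W * w.
    have -> : u x `^ (a - 1) = u x `^ a / u x.
      by rewrite powRB ?powRr1 ?(ltW (u0 x)) // un implybT.
    by rewrite ze1 /W /w -!mulrA; congr (_ * _); rewrite mulrCA; congr (_ * _); rewrite mulrC.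
  have P3 : g x = W * (w ^+ 2 + f ^+ 2).
    rewrite /g.
    have -> : u x `^ (a - 2) = u x `^ a / u x ^+ 2.
      by rewrite powRB ?powR_mulrn ?(ltW (u0 x)) // un implybT.
    have -> : z x `^ (e + 2) = z x `^ e * z x ^+ 2 by rewrite powRD_ge0 // powR_mulrn.
    have -> : u x `^ (a + 2 * p) = u x `^ a * (u x `^ p) ^+ 2.
      by rewrite powRD ?un ?implybT // mulrDl mul1r powRD ?un ?implybT // expr2.
    have -> : z x `^ (e + q) = z x `^ e * (z x `^ (q / 2)) ^+ 2.
      by rewrite {1}[q]splitr !powRD_ge0 // ?addr_ge0 // expr2.
    rewrite /W /w /f exprMn exprVn exprMn.
    by move: (u x `^ a) (z x `^ e) (u x ^- 2) (z x ^+ 2) (u x `^ p) (z x `^ (q / 2)); clear => *; ring.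
  have P4 : u x `^ a * z x `^ (e + 1) = W * z x by rewrite ze1 mulrA.
  set D1 := \sum_i deta rho i x * partial_deriv i u x in B1 *.
  set D2 := \sum_i deta rho i x * hessgrad u i x in B2 *.
  have TE : - T rho x = eta rho x * (W * (hess2 u x - f ^+ 2 + a * w * (hessnn u x + f)
       + 2 * e * (hessn2 u x + f * hessnn u x)
       - k * ((a + p) * f * w + (2 * e + q) * f * hessnn u x - f ^+ 2)
       - s * ((a - 1) * w ^+ 2 + 2 * (e + 1) * hessnn u x * w - f * w)))
     + W * (f * D1 + D2 - k * (f * D1) - s * (w * D1)).
    rewrite /T /S3 /S P1 P2 -/W (solution_laplacian x hu) -/(z x) -/f -/w -/D1 -/D2.
    by move: (hess2 u x) (hessnn u x) (hessn2 u x) (eta rho x); clear; clearbody D1 D2 W w f => *; field.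
  pose t1 := theta rho%:R x ^+ K.+1.
  pose t0 := c1 * (theta rho%:R x ^+ K / rho%:R * Num.sqrt (z x)).
  have t10 : 0 <= t1 by rewrite exprn_ge0.
  have t00 : 0 <= t0.
    by rewrite mulr_ge0 ?(ltW c10) // mulr_ge0 ?sqrtr_ge0 // divr_ge0 ?exprn_ge0 // ltW.
  have t01 : N%:R * (4 * K.+1%:R / rho%:R * theta rho%:R x ^+ (2 * K).+1) * Num.sqrt (z x) = t0 * t1.
    have -> : ((2 * K).+1 = K + K.+1)%N by rewrite addnS addnn mul2n.
    rewrite /t0 /t1 /c1 exprD.
    by move: (theta rho%:R x ^+ K) (theta rho%:R x ^+ K.+1) (Num.sqrt (z x)) (rho%:R^-1); clear => *; ring.
  rewrite -/(z x) t01 in B1.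
  have B2' : `|D2| <= N%:R * Num.sqrt (hess2 u x) * (t0 * t1).
    apply: le_trans B2 _; rewrite -t01 -/(z x) le_eqVlt; apply/orP; left; apply/eqP.
    move: (Num.sqrt (hess2 u x)) (Num.sqrt (z x)) (theta _ x ^+ _); clear => *; ring.
  have H20 : 0 <= hess2 u x.
    by apply: sumr_ge0 => i _; apply: sumr_ge0 => j _; exact: sqr_ge0.
  have := boundary_absorb k s d0 (ler0n R N) f0 w0 (sqrtr_ge0 (hess2 u x)) t00 t10 B1 B2'.
  rewrite sqr_sqrtr // -/C0 => BA.
  have t1E : t1 ^+ 2 = eta rho x by rewrite /t1 /eta -exprM mulnC.
  have t0E : t0 ^+ 2 = c1 ^+ 2 * (theta rho%:R x ^+ (2 * K) * rho%:R ^- 2 * z x).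
    by rewrite /t0 !exprMn sqr_sqrtr // exprVn -exprM mulnC.
  have eta0 : 0 <= eta rho x by rewrite exprn_ge0.
  have Q1 := ler_wpM2l eta0 Q.
  have BW := ler_wpM2l W0 BA.
  rewrite -(ler_pM2l (_ : 0 < d / 4)); last by rewrite divr_gt0.
  have dn := lt0r_neq0 d0; have cn := lt0r_neq0 c20.
  have -> : d / 4 * (- (4 / d) * T rho x + 4 / d * (c2 * C) * rho%:R `^ (- (2 / si)))
     = - T rho x + c2 * (C * rho%:R `^ (- (2 / si))).
    by move: (T rho x) (rho%:R `^ (- (2 / si))) => A B; clear -dn; field.
  have Y1 := ler_wpM2l (ltW c20) Y.
  have Y2 : W * (c2 * (theta rho%:R x ^+ (2 * K) * rho%:R ^- 2 * z x)) <=
     d / 4 * (eta rho x * g x) + c2 * (C * rho%:R `^ (- (2 / si))).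
    have cc : c2 * (d / 4 / c2) = d / 4 by rewrite mulrC divfK.
    move: Y1; rewrite P4 mulrDr [c2 * (d / 4 / c2 * _)]mulrA cc; apply: le_trans.
    rewrite le_eqVlt; apply/orP; left; apply/eqP.
    by move: (theta rho%:R x ^+ (2 * K)) (rho%:R ^- 2) (z x); clear; clearbody W c2 => *; ring.
  have c2E : 3 * (C0 ^+ 2 / (2 * d)) * t0 ^+ 2 = c2 * (theta rho%:R x ^+ (2 * K) * rho%:R ^- 2 * z x).
    by rewrite t0E /c2 [LHS]mulrA.
  rewrite c2E t1E in BW; rewrite TE P3.
  rewrite P3 in Y2.
  have nn : 0 <= d / 2 * (eta rho x * (W * hess2 u x)).
    by rewrite mulr_ge0 ?divr_ge0 ?(ltW d0) // mulr_ge0 // mulr_ge0.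
  exact: (combine_estimates Q1 BW Y2 nn).
move=> x; have /eqP := gz x.
rewrite /g paddr_eq0 ?mulr_ge0 ?powR_ge0 // mulf_eq0 => /andP [+ _].
rewrite (negPf (lt0r_neq0 (powR_gt0 _ (u0 x)))) /= powR_eq0 => /andP [/eqP zx _]; exact: zx.
Qed.

Theorem theoremC (R : realType) (N : nat) (p q : R)
    (hN : (2 <= N)%N) (hp : 0 <= p) (hq0 : 0 <= q) (hq2 : q < 2)
    (hG : Gpoly N p q < 0) (u : 'rV[R]_N -> R)
    (hu : positive_solution p q u) :
  exists c : R, forall x : 'rV[R]_N, u x = c.
Proof.
have [[cu1 _] _ _] := hu.
suff z0 : forall x, sqgrad u x = 0 by exact: sqgrad0_cst cu1 z0.
have [sub|sup] := ltP ((N%:R - 2) * p + (N%:R - 1) * q) N%:R.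
  exact: supersolution_sqgrad0 sub hu.
have N3 : (3 <= N)%N.
  rewrite ltn_neqAle hN andbT; apply/eqP => N2.
  by move: sup; rewrite -N2 subrr mul0r add0r leNgt => /negP; apply; lra.
have hGm : Gm (N%:R - 1) p q < 0.
  by rewrite (_ : Gm _ _ _ = Gpoly N p q) // /Gm /Gpoly /bpoly; ring.
have [e [a [k [s hpar]]]] := good_params_exist N3 hq0 hq2 hp sup hGm.
have pq : 1 < p + q.
  have n0 : 0 < N%:R - 2 :> R.
    by rewrite subr_gt0 (ltr_nat R 2).
  rewrite -subr_gt0 -(pmulr_rgt0 _ n0).
  by apply: lt_le_trans (_ : 2 - q <= _); [rewrite subr_gt0|lra].
exact: good_params_sqgrad0 hN hp hq0 hq2 pq hpar hu.
Qed.
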